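(* Let $\sigma_W>0$. For positive integers $m,n$ let $W\in\mathbb{R}^{m\times n}$ have i.i.d. entries $W_{i,j}\sim\mathcal{N}(0,\sigma_W^2)$, and let $H\in\mathbb{R}^{mn\times mn}$, $A\in\mathbb{R}^{n\times n}$ and $B\in\mathbb{R}^{m\times m}$ be symmetric positive definite. Fix an entropy coding scheme that encodes the integer matrix $Z$ with expected length $\mathrm{Ent}(Z)+o(mn)$ bits. Let $L^{(A)}=\mathrm{RevCholesky}(A)$ and $L^{(B)}=\mathrm{RevCholesky}(B)$. For $\gamma>0$, run the two-sided GPTQ algorithm (described in the context) on $(W,A,B,\alpha,\beta)$ with scales $$\alpha_j=\sqrt{\gamma}\cdot\frac{|A|^{1/(2n)}}{L^{(A)}_{j,j}}\quad(1\le j\le n),\qquad \beta_i=\sqrt{\gamma}\cdot\frac{|B|^{1/(2m)}}{L^{(B)}_{i,i}}\quad(1\le i\le m),$$ and encode its output $Z$ with the entropy coding scheme. Then the distortion $D_H$ and the rate $R$ satisfy $$D_H=\frac{\gamma^2}{12}\,|A|^{1/n}|B|^{1/m}\,\frac{\operatorname{tr}\!\big(H(A\otimes B)^{-1}\big)}{mn}\,(1+o(1)),\qquad R=\tfrac12\log_2(2\pi e\,\sigma_W^2)-\log_2\gamma+o(1)$$ as $\gamma\to0$ and $mn\to\infty$. Consequently the rate-distortion tradeoff $$D_H=\frac{2\pi e}{12}\,\sigma_W^2\,|A|^{1/n}|B|^{1/m}\,\frac{\operatorname{tr}\!\big(H(A\otimes B)^{-1}\big)}{mn}\,2^{-2R}\,(1+o(1))$$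 holds.
   Context: Notation. $|M|$ is the determinant of a square matrix $M$. $\operatorname{vec}$ is column-major vectorization and $\otimes$ the Kronecker product. For a symmetric positive definite $M$, $\mathrm{RevCholesky}(M)$ is the unique lower-triangular $L$ with positive diagonal entries such that $L^TL=M$, and $M^{1/2}$ is any matrix $S$ with $SS^T=M$ (the quantities below do not depend on the choice). $\|\cdot\|_F$ is the Frobenius norm. $\mathrm{Ent}(Z)$ is the Shannon entropy, in bits, of the random integer matrix $Z$. Quantized matrix. Given $Z\in\mathbb{Z}^{m\times n}$ and scales $\alpha\in\mathbb{R}_{>0}^n$, $\beta\in\mathbb{R}_{>0}^m$, the quantized matrix is $V\in\mathbb{R}^{m\times n}$ with $V_{i,j}=\alpha_j\beta_iZ_{i,j}$. Two-sided GPTQ algorithm. Input: $W,A,B,\alpha,\beta$. Let $L^{(A)}=\mathrm{RevCholesky}(A)$, $L^{(B)}=\mathrm{RevCholesky}(B)$, and let $\tilde L^{(A)}$, $\tilde L^{(B)}$ be obtained from $(L^{(A)})^{-1}$, $(L^{(B)})^{-1}$ by dividing each column by its diagonal entry. Maintain a working copy $W'$, initially $W'=W$. For $j=1,\dots,n$ (outer loop) and $i=1,\dots,m$ (inner loop): set $Z_{i,j}=\mathrm{round}(W'_{i,j}/(\alpha_j\beta_i))$ (nearest integer), $V_{i,j}=\alpha_j\beta_iZ_{i,j}$, $\Delta=V_{i,j}-W'_{i,j}$, and update $W'\leftarrow W'+\Delta\,\tilde L^{(B)}_{:,i}(\tilde L^{(A)}_{:,j})^T$, where $M_{:,k}$ denotes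 the $k$-th column of $M$. Output: $Z$ (and hence $V$). Distortion and rate. With $W$ the original matrix, $$D_H=\frac1{mn}\mathbb{E}_W\big[\|(\operatorname{vec}(V)^T-\operatorname{vec}(W)^T)H^{1/2}\|_F^2\big],$$ and $R=\frac1{mn}$ times the expected (over $W$) length of the self-delimiting (prefix-free) binary string encoding $Z$. The matrices $H,A,B$ are deterministic. The scales $\alpha,\beta$ are not encoded: the decoder is given access to them (equivalently to $A,B$). Meaning of the limit. The joint limit $\gamma\to0$, $mn\to\infty$ is understood in the iterated sense: first $\gamma\to0$ for fixed $m,n,H,A,B$, then $mn\to\infty$. That is, a quantity $\varepsilon$ depending on $(m,n,H,A,B,\gamma)$ is $o(1)$ if for every sequence $(m_k,n_k,H_k,A_k,B_k)$ of such data with $m_kn_k\to\infty$ one has $\lim_{k\to\infty}\limsup_{\gamma\to0}|\varepsilon(m_k,n_k,H_k,A_k,B_k,\gamma)|=0$; and a quantity is $o(mn)$ if it equals $mn\cdot o(1)$ in this sense. $\sigma_W$ is fixed. *)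

(* Defs.v *)
From HB Require Import structures.
From mathcomp Require Import all_boot all_order all_algebra.
From mathcomp Require Export mxtens.
From mathcomp Require Import all_classical all_reals all_analysis.

Set Implicit Arguments.
Unset Strict Implicit.
Unset Printing Implicit Defensive.

Import Order.TTheory GRing.Theory Num.Theory.
Import numFieldNormedType.Exports.

Local Open Scope classical_set_scope.
Local Open Scope ring_scope.

Definition log2 {R : realType} (x : R) : R := ln x / ln 2.

Definition posdefmx {R : realType} {n : nat} (M : 'M[R]_n) : Prop :=
  M^T = M /\ forall x : 'cV[R]_n, x != 0 -> 0 < (x^T *m M *m x) 0 0.

(* [is_trig_mx] is MathComp's predicate for lower-triangular matrices. *)
Definition is_revCholesky {R : realType} {n : nat} (M L : 'M[R]_n) : Prop :=
  [/\ is_trig_mx L, forall i, 0 < L i i & L^T *m L = M].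

Definition revCholesky {R : realType} {n : nat} (M : 'M[R]_n) : 'M[R]_n :=
  xget 0 [set L | is_revCholesky M L].

Definition frobenius_norm {R : realType} {m n : nat} (M : 'M[R]_(m, n)) : R :=
  Num.sqrt (\sum_i \sum_j M i j ^+ 2).

(* Column-major: the entry (i, j) of M has index j * m + i.  MathComp's [mxvec]
   is row-major; [mxtens_unindex] is the indexing of the Kronecker product
   [_ *t _], so that vec (X M Y^T) = (Y *t X) vec M. *)
Definition vec {R : realType} {m n : nat} (M : 'M[R]_(m, n)) : 'cV[R]_(n * m) :=
  \col_k M (mxtens_unindex k).2 (mxtens_unindex k).1.

(* Ties are broken arbitrarily. *)
Definition nearest_integer {R : realType} (rnd : R -> int) : Prop :=
  forall x, `|x - (rnd x)%:~R| <= 2^-1.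

Definition dequantize {R : realType} {m n : nat}
    (alpha : 'I_n -> R) (beta : 'I_m -> R) (Z : 'M[int]_(m, n)) : 'M[R]_(m, n) :=
  \matrix_(i, j) (alpha j * beta i * (Z i j)%:~R).

Section GPTQ.
Context {R : realType} (rnd : R -> int) {m n : nat}.
Variables (A : 'M[R]_n) (B : 'M[R]_m) (alpha : 'I_n -> R) (beta : 'I_m -> R).

Definition normalized_inv {k : nat} (L : 'M[R]_k) : 'M[R]_k :=
  \matrix_(i, j) (invmx L i j / invmx L j j).

(* The state consists of the entries of Z assigned so far and of W'. *)
Definition gptq_step (ZW : 'M[int]_(m, n) * 'M[R]_(m, n)) (ij : 'I_m * 'I_n) :
    'M[int]_(m, n) * 'M[R]_(m, n) :=
  let: (Z, W') := ZW in
  let: (i, j) := ij in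
  let z := rnd (W' i j / (alpha j * beta i)) in
  let delta := alpha j * beta i * z%:~R - W' i j in
  (\matrix_(k, l) (if (k == i) && (l == j) then z else Z k l),
   W' + delta *: (col i (normalized_inv (revCholesky B)) *m
                  (col j (normalized_inv (revCholesky A)))^T)).

Definition gptq (W : 'M[R]_(m, n)) : 'M[int]_(m, n) :=
  (foldl gptq_step (0, W) [seq (i, j) | j <- enum 'I_n, i <- enum 'I_m]).1.

End GPTQ.

(* alpha_j for M = A, and beta_i for M = B. *)
Definition gptq_scale {R : realType} {k : nat} (gamma : R) (M : 'M[R]_k)
    (j : 'I_k) : R :=
  Num.sqrt gamma * \det M `^ (2 * k%:R)^-1 / revCholesky M j j.

Section Probability.
Context {d : measure_display} {T : measurableType d} {R : realType}.
Variable P : probability T R.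

Definition mutually_independent {I : finType} (X : I -> T -> R) : Prop :=
  forall (J : {set I}) (E : I -> set R), (forall i, measurable (E i)) ->
    P (\bigcap_(i in [set` J]) (X i @^-1` E i)) =
    (\prod_(i in J) P (X i @^-1` E i))%E.

Definition iid_normal {m n : nat} (sigma : R)
    (X : 'I_m -> 'I_n -> {RV P >-> R}) : Prop :=
  (forall i j (E : set R), measurable E ->
     distribution P (X i j) E = normal_prob 0 sigma E) /\
  mutually_independent (fun ij : 'I_m * 'I_n => X ij.1 ij.2 : T -> R).

Definition random_matrix {m n : nat} (X : 'I_m -> 'I_n -> {RV P >-> R})
    (w : T) : 'M[R]_(m, n) :=
  \matrix_(i, j) X i j w.

Definition entropy {S : choiceType} (X : T -> S) : \bar R :=
  (\esum_(s in [set: S])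
     (let p := fine (P (X @^-1` [set s])) in (- (p * log2 p))%R%:E))%E.

Definition expected_length {S : Type} (code : S -> seq bool) (X : T -> S) :
    \bar R :=
  ('E_P [fun w => ((size (code (X w)))%:R : R)%R])%E.

(* Hhalf stands for H^{1/2}. *)
Definition distortion {m n : nat} (Hhalf : 'M[R]_(n * m))
    (W V : T -> 'M[R]_(m, n)) : \bar R :=
  (((m * n)%:R^-1 : R)%R%:E *
   'E_P [fun w => frobenius_norm (((vec (V w))^T - (vec (W w))^T) *m Hhalf)
                  ^+ 2]%R)%E.

Definition rate {m n : nat} (code : 'M[int]_(m, n) -> seq bool)
    (Z : T -> 'M[int]_(m, n)) : \bar R :=
  (((m * n)%:R^-1 : R)%R%:E * expected_length code Z)%E.

End Probability.

Definition prefix_free {S : Type} (code : S -> seq bool) : Prop :=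
  forall s t : S, prefix (code s) (code t) -> s = t.

Record gptq_data (R : realType) := GPTQData {
  nrow : nat;
  ncol : nat;
  matH : 'M[R]_(ncol * nrow);
  matA : 'M[R]_ncol;
  matB : 'M[R]_nrow;
  nrow_gt0 : (0 < nrow)%N;
  ncol_gt0 : (0 < ncol)%N;
  matH_posdef : posdefmx matH;
  matA_posdef : posdefmx matA;
  matB_posdef : posdefmx matB }.

Section Asymptotics.
Context {R : realType}.
Implicit Types X Y eps : gptq_data R -> R -> \bar R.

(* The iterated limit: gamma -> 0 for fixed (m, n, H, A, B), then mn -> oo. *)
Definition is_o1 eps : Prop :=
  forall s : nat -> gptq_data R,
    (nrow (s k) * ncol (s k))%N @[k --> \oo] --> \oo ->
    limf_esup (fun gamma : R => `|eps (s k) gamma|%E) 0^'+ @[k --> \oo]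
      --> 0%E.

(* X = Y + o(1) *)
Definition eq_add_o1 X Y : Prop :=
  exists2 eps, is_o1 eps &
    forall x (gamma : R), 0 < gamma -> X x gamma = (Y x gamma + eps x gamma)%E.

(* X = Y + o(mn) *)
Definition eq_add_omn X Y : Prop :=
  exists2 eps, is_o1 eps &
    forall x (gamma : R), 0 < gamma ->
      X x gamma = (Y x gamma + (nrow x * ncol x)%:R%:E * eps x gamma)%E.

(* X = Y (1 + o(1)) *)
Definition eq_mul_1o1 X Y : Prop :=
  exists2 eps, is_o1 eps &
    forall x (gamma : R), 0 < gamma -> X x gamma = (Y x gamma * (1 + eps x gamma))%E.

(* |A|^{1/n} |B|^{1/m} tr(H (A (x) B)^{-1}) / (mn) *)
Definition hessian_factor (x : gptq_data R) : R :=
  \det (matA x) `^ (ncol x)%:R^-1 * \det (matB x) `^ (nrow x)%:R^-1 *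
  (\tr (matH x *m invmx (matA x *t matB x)) / (nrow x * ncol x)%:R).

End Asymptotics.

(* Main.v *)
(** Order the entries of [W] as the algorithm treats them.  The entry [i] is
    rounded to [Z_i = rnd x_i] with [x_i = W_i / s_i + a_i], where
    [s_i = alpha_j beta_i] and the feedback [a_i] is a fixed linear combination
    of the earlier rounding errors [u_k = rnd x_k - x_k]: it is bounded and
    independent of [W_i].  The scales are such that [prod_i s_i = gamma ^ mn],
    and since the update directions [S_k] are triangular, the final working copy
    is [V], so that [V - W = sum_k s_k u_k S_k].

    Conditionally on the past, [W_i] has a normal density that is almost constant
    on an interval of length [s_i]; hence [u_i] is almost uniform on [[-1/2, 1/2]]
    and almost uncorrelated with the past, which gives the distortion.  The same
    remark, iterated, shows that [- ln P(Z = z)], evaluated at [z = Z], is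
    [sum_i (W_i^2 / (2 sigma^2) - ln (s_i / (sigma sqrt(2 pi))))] up to an error
    with expectation O(gamma); the expectation of this is the entropy of [Z], and
    only the second moment of the normal law is needed to evaluate it. *)

Require Import Defs.
From HB Require Import structures.
From mathcomp Require Import all_boot all_order all_algebra.
From mathcomp Require Import all_classical all_reals all_analysis.
From mathcomp Require Import measurable_realfun.
From mathcomp Require Import ring lra.

Set Implicit Arguments.
Unset Strict Implicit.
Unset Printing Implicit Defensive.

Import Order.TTheory GRing.Theory Num.Theory.
Import numFieldNormedType.Exports.

Local Open Scope classical_set_scope.
Local Open Scope ring_scope.

(** * Triangular factors and Kronecker products *)

(** No conditional law is computed. Freezing the past turns the feedback into a constant [b], so
    each estimate is proved for one normal variable, uniformly in the shift [b], and then averaged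
    against a nonnegative function of the past. Ties of [rnd] concern only endpoints of intervals.

    For the distortion, one-sided bounds suffice: a quadratic that is nonnegative on [-1/2, 1/2] has
    a mean of at least [1 - e] times its mean under the uniform law. Applied to pairs such as
    [1/2 + u] and [1/2 - u], this yields two-sided estimates.

    For the entropy, the obstacle is that the integers [z] do not determine the past errors, hence
    not the exact interval of the next entry. The errors being bounded, this interval stays within
    [radius] steps of the integer, so density bounds that depend on [z] alone can be multiplied
    along the order of the entries.

    The constants depend on m, n, H, A, B but not on gamma, which is enough because gamma tends to 0
    first. This rests on the feedback coefficients containing only ratios of scales, from which
    gamma cancels. *)

Section LinearAlgebra.
Context {R : realType}.

(** In [L^T *m L] the last row of [L] alone determines the last row and column, so it can be read
    off from [M]; the remaining block of [L] must then factor the Schur complement of the last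
    diagonal entry. This is why the induction peels off the last index. *)
Lemma revCholesky_exists_block n :
  (forall M : 'M[R]_n, posdefmx M -> exists L, is_revCholesky M L) ->
  forall M : 'M[R]_(n + 1), posdefmx M -> exists L, is_revCholesky M L.
Proof.
move=> IH M [Msym Mpos].
pose M1 := ulsubmx M; pose v := ursubmx M; pose c := M (rshift n 0) (rshift n 0).
have M1sym : M1^T = M1 by rewrite /M1 trmx_ulsub Msym.
have dlE : dlsubmx M = v^T by rewrite /v trmx_ursub Msym.
have drE : drsubmx M = c%:M.
  by apply/matrixP => i j; rewrite !ord1 !mxE eqxx mulr1n.
have ME : M = block_mx M1 v v^T c%:M by rewrite -[M in LHS]submxK dlE drE.
have c_gt0 : 0 < c.
  have /Mpos : col_mx (0 : 'cV[R]_n) (1%:M : 'cV[R]_1) != 0.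
    apply/eqP => /(congr1 dsubmx); rewrite col_mxKd => /matrixP/(_ 0 0).
    by rewrite !mxE/= => /eqP; rewrite oner_eq0.
  rewrite ME tr_col_mx mul_row_block mul_row_col !trmx0 !mul0mx !mulmx0 !add0r.
  by rewrite trmx1 mul1mx mulmx1 mxE eqxx mulr1n.
have c_neq0 : c != 0 by rewrite gt_eqF.
pose S := M1 - c^-1 *: (v *m v^T).
have Spos : posdefmx S.
  split; first by rewrite /S linearB linearZ/= trmx_mul trmxK M1sym.
  (* This [y] minimizes the form of [M] over the last coordinate: the last block of
     [(col_mx x y)^T *m M] vanishes, and the form of [S] at [x] remains. *)
  move=> x x_neq0; pose y := - c^-1 *: (v^T *m x).
  have /Mpos : col_mx x y != 0.
    by apply: contra_neq x_neq0 => /(congr1 usubmx); rewrite col_mxKu linear0.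
  rewrite ME tr_col_mx mul_row_block mul_row_col.
  have yT : y^T = - c^-1 *: (x^T *m v) by rewrite linearZ/= trmx_mul trmxK.
  have -> : x^T *m v + y^T *m c%:M = 0.
    by rewrite mul_mx_scalar yT scalerA mulrN divff// scaleN1r subrr.
  rewrite mul0mx addr0 yT /S mulmxBr mulmxBl mulmxDl -!scalemxAl scaleNr.
  by rewrite -scalemxAr -scalemxAl !mulmxA.
have [L1 [L1trig L1pos L1E]] := IH _ Spos.
have sc : Num.sqrt c * Num.sqrt c = c by rewrite -expr2 sqr_sqrtr// ltW.
have sc0 : Num.sqrt c != 0 by rewrite sqrtr_eq0 -ltNge.
exists (block_mx L1 0 ((Num.sqrt c)^-1 *: v^T) (Num.sqrt c)%:M); split.
- rewrite is_trig_block_mx// eqxx L1trig/=; apply/is_trig_mxP => i j.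
  by rewrite !ord1.
- move=> i; case: (split_ordP i) => j ->.
    by rewrite block_mxEul.
  by rewrite block_mxEdr !ord1 mxE eqxx mulr1n sqrtr_gt0.
- have lT : ((Num.sqrt c)^-1 *: v^T)^T = (Num.sqrt c)^-1 *: v.
    by rewrite linearZ/= trmxK.
  rewrite ME tr_block_mx mulmx_block trmx0 !mul0mx !mulmx0 !add0r tr_scalar_mx lT.
  congr block_mx.
  + rewrite -scalemxAl -scalemxAr scalerA -invfM sc L1E.
    by rewrite /S subrK.
  + by rewrite mul_mx_scalar scalerA divff// scale1r.
  + by rewrite mul_scalar_mx scalerA divff// scale1r.
  + by rewrite mul_scalar_mx scale_scalar_mx sc.
Qed.

Lemma revCholesky_exists n (M : 'M[R]_n) :
  posdefmx M -> exists L, is_revCholesky M L.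
Proof.
elim: n M => [M _|n /revCholesky_exists_block].
  exists 0; split=> [|[]//|]; last by apply/matrixP => -[].
  by apply/is_trig_mxP => -[].
by rewrite addn1; apply.
Qed.

Lemma revCholeskyP n (M : 'M[R]_n) :
  posdefmx M -> is_revCholesky M (revCholesky M).
Proof. by move=> /revCholesky_exists[L ML]; exact: (xgetI _ ML). Qed.

Section Triangular.
Variables (n : nat) (L : 'M[R]_n).
Hypotheses (Ltrig : is_trig_mx L) (Lpos : forall i, 0 < L i i).

Lemma trig_unitmx : L \in unitmx.
Proof.
by rewrite unitmxE det_trig// unitfE gt_eqF// prodr_gt0.
Qed.

(** Strong induction on the row: in the entry [(i, j)] of [L *m invmx L], the terms from earlier
    rows of the inverse vanish by induction and those from later columns of [L] by triangularity,
    which isolates [L i i * invmx L i j]. *)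
Lemma invmx_trig (i j : 'I_n) : (i < j)%N -> invmx L i j = 0.
Proof.
have [k] := ubnP (i : nat); elim: k i => // k IH i; rewrite ltnS => ik ij.
have /matrixP/(_ i j) := mulmxV trig_unitmx.
rewrite !mxE (bigD1 i)//= big1 ?addr0.
  rewrite -val_eqE/= ltn_eqF// mulr0n => /eqP.
  by rewrite mulf_eq0 gt_eqF//= => /eqP.
move=> l; rewrite -val_eqE/= neq_ltn => /orP[li|il].
  by rewrite IH ?mulr0 ?(leq_trans li ik) ?(ltn_trans li ij).
by move/is_trig_mxP : Ltrig => ->//; rewrite mul0r.
Qed.

Lemma invmx_trig_diag (i : 'I_n) : invmx L i i = (L i i)^-1.
Proof.
have /matrixP/(_ i i) := mulmxV trig_unitmx.
rewrite !mxE (bigD1 i)//= big1 ?addr0.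
  rewrite eqxx mulr1n => H; apply: (mulfI (lt0r_neq0 (Lpos i))).
  by rewrite H divff// gt_eqF.
move=> l; rewrite -val_eqE/= neq_ltn => /orP[li|il].
  by rewrite invmx_trig ?mulr0.
by move/is_trig_mxP : Ltrig => ->//; rewrite mul0r.
Qed.

Lemma normalized_invE (i j : 'I_n) :
  normalized_inv L i j = invmx L i j * L j j.
Proof. by rewrite mxE invmx_trig_diag invrK. Qed.

Lemma normalized_inv_trig (i j : 'I_n) :
  (i < j)%N -> normalized_inv L i j = 0.
Proof. by move=> ij; rewrite mxE invmx_trig// mul0r. Qed.

Lemma normalized_inv_diag (i : 'I_n) : normalized_inv L i i = 1.
Proof. by rewrite normalized_invE invmx_trig_diag mulVf// gt_eqF. Qed.

End Triangular.

Lemma det_revCholesky n (M : 'M[R]_n) : posdefmx M ->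
  \det M = (\prod_i revCholesky M i i) ^+ 2.
Proof.
move=> /revCholeskyP[Lt _ LM].
by rewrite -[in LHS]LM det_mulmx det_tr det_trig// expr2.
Qed.

Lemma posdef_det_gt0 n (M : 'M[R]_n) : posdefmx M -> 0 < \det M.
Proof.
move=> Mpos; have [_ L0 _] := revCholeskyP Mpos.
by rewrite det_revCholesky// exprn_gt0// prodr_gt0.
Qed.

Lemma posdef_tr_gt0 n (M : 'M[R]_n) : (0 < n)%N -> posdefmx M -> 0 < \tr M.
Proof.
move=> n0 [_ Mpos].
have M0 (i : 'I_n) : 0 < M i i.
  have /Mpos : delta_mx i (0 : 'I_1) != 0 :> 'cV[R]_n.
    apply/eqP => /matrixP/(_ i 0); rewrite !mxE !eqxx => /eqP.
    by rewrite oner_eq0.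
  by rewrite trmx_delta -rowE -colE !mxE.
rewrite /mxtrace (bigD1 (Ordinal n0))//= ltr_pwDl//.
by apply: sumr_ge0 => i _; exact: ltW.
Qed.

Lemma posdef_congr n (M G : 'M[R]_n) : G \in unitmx -> posdefmx M ->
  posdefmx (G^T *m M *m G).
Proof.
move=> Gu [Ms Mp]; split; first by rewrite !trmx_mul trmxK Ms mulmxA.
move=> x x0; have /Mp : G *m x != 0.
  by apply: contra_neq x0 => /(congr1 (mulmx (invmx G))); rewrite mulKmx// mulmx0.
by rewrite trmx_mul !mulmxA.
Qed.

Lemma invmx_eq n (M N : 'M[R]_n) : M *m N = 1%:M -> invmx M = N.
Proof.
move=> MN; have [Mu _] := mulmx1_unit MN.
by rewrite -[LHS]mulmx1 -MN mulKmx.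
Qed.

Lemma tens1mx1 m n : (1%:M : 'M[R]_m) *t (1%:M : 'M[R]_n) = 1%:M.
Proof.
apply/matrixP => k l.
case: (mxtens_indexP k) => a b; case: (mxtens_indexP l) => c e.
rewrite !mxE !mxtens_indexK/= .
by rewrite (can_eq (@mxtens_indexK m n)) xpair_eqE -natrM mulnb.
Qed.

Lemma invmx_tens m n (M : 'M[R]_m) (N : 'M[R]_n) :
  M \in unitmx -> N \in unitmx -> invmx (M *t N) = invmx M *t invmx N.
Proof.
move=> Mu Nu; apply: invmx_eq.
by rewrite tensmx_mul !mulmxV// tens1mx1.
Qed.

Lemma invmx_revCholesky n (M : 'M[R]_n) : posdefmx M ->
  invmx M = invmx (revCholesky M) *m (invmx (revCholesky M))^T.
Proof.
move=> /revCholeskyP[Lt L0 LM]; have Lu := trig_unitmx Lt L0.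
apply: invmx_eq; rewrite -[X in X *m _]LM -mulmxA mulKVmx// -trmx_mul.
by rewrite mulVmx// trmx1.
Qed.

Lemma vec_mulmx m n (X : 'M[R]_m) (Y : 'M[R]_n) (M : 'M[R]_(m, n)) :
  vec (X *m M *m Y^T) = (Y *t X) *m vec M.
Proof.
apply/matrixP => k l; rewrite !mxE.
case: (mxtens_indexP k) => j i; rewrite mxtens_indexK/=.
rewrite (reindex (@mxtens_index n m)) /=; last first.
  by exists (@mxtens_unindex n m) => ? _; rewrite ?mxtens_indexK ?mxtens_unindexK.
rewrite (eq_bigr (fun q : 'I_n * 'I_m => Y j q.1 * (X i q.2 * M q.2 q.1))); last first.
  by case=> a b _; rewrite !mxE !mxtens_indexK mulrA.
rewrite -(pair_bigA _ (fun a b => Y j a * (X i b * M b a)))/=.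
apply: eq_bigr => a _; rewrite !mxE mulr_suml; apply: eq_bigr => b _.
by rewrite mulrC.
Qed.

End LinearAlgebra.

(** * The GPTQ recursion *)

Section GPTQRecursion.
Context {m n : nat}.
Implicit Types ij kl : 'I_m * 'I_n.

Definition gptq_order : seq ('I_m * 'I_n) :=
  [seq (i, j) | j <- enum 'I_n, i <- enum 'I_m].

(** The time at which an entry is treated. Being an injective natural number, it supports induction
    and is all that the probabilistic part needs to know of the order. *)
Definition gptq_rank ij := index ij gptq_order.

Lemma gptq_order_uniq : uniq gptq_order.
Proof.
apply: allpairs_uniq; rewrite ?enum_uniq//.
by move=> [i j] [k l] _ _ /= [-> ->].
Qed.

Lemma mem_gptq_order ij : ij \in gptq_order.
Proof.
by case: ij => i j; apply/allpairsP; exists (j, i); rewrite !mem_enum.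
Qed.

Lemma gptq_rank_inj : injective gptq_rank.
Proof. by move=> ij kl; apply: index_inj (mem_gptq_order ij) (mem_gptq_order kl). Qed.

Lemma gptq_rank_lt ij : (gptq_rank ij < size gptq_order)%N.
Proof. by rewrite index_mem mem_gptq_order. Qed.

Definition gptq_before ij kl :=
  (ij.2 < kl.2)%N || (ij.2 == kl.2) && (ij.1 < kl.1)%N.

Lemma gptq_order_pairwise : pairwise gptq_before gptq_order.
Proof.
have sI k : pairwise (fun i j : 'I_k => (i < j)%N) (enum 'I_k).
  have : pairwise ltn (map val (enum 'I_k)).
    rewrite val_enum_ord -sorted_pairwise; last exact: ltn_trans.
    exact: iota_ltn_sorted.
  by rewrite pairwise_map.
rewrite /gptq_order; elim: (enum 'I_n) (sI n) => //= j s IH /andP[js /IH IHs].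
rewrite pairwise_cat IHs andbT; apply/andP; split.
  apply/allrelP => -[i1 j1] [i2 j2] /mapP[i _ [-> ->]].
  case/allpairsP => -[a b] /= [as_ _ [-> ->]].
  by rewrite /gptq_before/= (allP js).
rewrite pairwise_map; apply: sub_pairwise (sI m) => a b ab.
by rewrite /gptq_before/= eqxx ab orbT.
Qed.

Lemma gptq_rankP ij kl : (gptq_rank ij < gptq_rank kl)%N -> gptq_before ij kl.
Proof.
move=> lt; have /pairwiseP - /(_ ij) := gptq_order_pairwise.
move=> /(_ (gptq_rank ij) (gptq_rank kl)).
by rewrite !inE !gptq_rank_lt !nth_index ?mem_gptq_order//; apply.
Qed.

Context {R : realType} (rnd : R -> int).
Variables (A : 'M[R]_n) (B : 'M[R]_m) (alpha : 'I_n -> R) (beta : 'I_m -> R).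

Definition rounding_error (y : R) : R := (rnd y)%:~R - y.

Definition gptq_step_size ij : R := alpha ij.2 * beta ij.1.

Definition gptq_direction ij : 'M[R]_(m, n) :=
  col ij.1 (normalized_inv (revCholesky B)) *m
    (col ij.2 (normalized_inv (revCholesky A)))^T.

Definition gptq_state (W : 'M[R]_(m, n)) (t : nat) :=
  foldl (gptq_step rnd A B alpha beta) (0, W) (take t gptq_order).

(** The working copy is read at the rank of the entry itself, so this argument of [rnd] is a fixed
    function of [W], whatever the later steps do. *)
Definition gptq_input (W : 'M[R]_(m, n)) ij : R :=
  (gptq_state W (gptq_rank ij)).2 ij.1 ij.2 / gptq_step_size ij.

Lemma gptq_directionE ij k l : gptq_direction ij k l =
  normalized_inv (revCholesky B) k ij.1 * normalized_inv (revCholesky A) l ij.2.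
Proof. by rewrite !mxE big_ord1 !mxE. Qed.

Hypothesis step_size_neq0 : forall ij, gptq_step_size ij != 0.

Lemma gptq_stepE ZW ij : gptq_step rnd A B alpha beta ZW ij =
  (\matrix_(k, l) (if (k, l) == ij
                   then rnd (ZW.2 ij.1 ij.2 / gptq_step_size ij) else ZW.1 k l),
   ZW.2 + (gptq_step_size ij *
           rounding_error (ZW.2 ij.1 ij.2 / gptq_step_size ij)) *:
          gptq_direction ij).
Proof.
rewrite /rounding_error mulrBr [X in _ - X]mulrCA divff// mulr1.
by case: ZW; case: ij.
Qed.

(** The invariant of the fold. Each entry of [Z] is written once, and each update is a fixed
    direction times an error that depends only on the state at its own rank, so the steps merely
    accumulate. *)
Lemma gptq_stateE W t : (t <= size gptq_order)%N ->
  (forall i j, (gptq_state W t).1 i j =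
     if (gptq_rank (i, j) < t)%N then rnd (gptq_input W (i, j)) else 0) /\
  (gptq_state W t).2 = W + \sum_(kl | (gptq_rank kl < t)%N)
     (gptq_step_size kl * rounding_error (gptq_input W kl)) *: gptq_direction kl.
Proof.
elim: t => [_|t IH ts].
  by rewrite /gptq_state take0/=; split=> [i j|]; rewrite ?mxE// big1 ?addr0.
have [Z W'] := IH (ltnW ts).
have x0 : 'I_m * 'I_n by case: gptq_order ts.
pose ij := nth x0 gptq_order t.
have rk : gptq_rank ij = t by rewrite /gptq_rank index_uniq ?gptq_order_uniq.
have rkS kl : (gptq_rank kl < t.+1)%N = (kl == ij) || (gptq_rank kl < t)%N.
  by rewrite ltnS leq_eqVlt -[in X in _ == X]rk (inj_eq gptq_rank_inj).
have stS : gptq_state W t.+1 =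
    gptq_step rnd A B alpha beta (gptq_state W t) ij.
  by rewrite /gptq_state (take_nth x0)// -cats1 foldl_cat.
have xE : (gptq_state W t).2 ij.1 ij.2 / gptq_step_size ij = gptq_input W ij.
  by rewrite /gptq_input rk.
rewrite stS gptq_stepE xE /=; split.
  by move=> k l; rewrite mxE Z rkS; case: eqP => // ->.
rewrite W' (eq_bigl _ _ rkS) [in RHS](bigD1 ij)/= ?eqxx// -addrA.
congr (_ + _); rewrite addrC; congr (_ + _).
apply: eq_bigl => kl; case: eqVneq => [->|]//=; last by rewrite andbT.
by rewrite rk ltnn.
Qed.

Lemma gptqE W i j : gptq rnd A B alpha beta W i j = rnd (gptq_input W (i, j)).
Proof.
have [+ _] := gptq_stateE W (leqnn (size gptq_order)).
by rewrite /gptq_state take_size => ->; rewrite gptq_rank_lt.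
Qed.

Lemma gptq_inputE W ij : gptq_input W ij = W ij.1 ij.2 / gptq_step_size ij +
  \sum_(kl | (gptq_rank kl < gptq_rank ij)%N)
     gptq_step_size kl / gptq_step_size ij * gptq_direction kl ij.1 ij.2 *
     rounding_error (gptq_input W kl).
Proof.
have [_ stE] := gptq_stateE W (ltnW (gptq_rank_lt ij)).
rewrite [in LHS]/gptq_input stE mxE mulrDl summxE mulr_suml.
by congr (_ + _); apply: eq_bigr => kl _; rewrite mxE; ring.
Qed.

Hypotheses (Apos : posdefmx A) (Bpos : posdefmx B).

Lemma gptq_direction_diag ij : gptq_direction ij ij.1 ij.2 = 1.
Proof.
have [LA A0 _] := revCholeskyP Apos; have [LB B0 _] := revCholeskyP Bpos.
by rewrite gptq_directionE !normalized_inv_diag// mulr1.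
Qed.

Lemma gptq_direction_before ij kl :
  gptq_before ij kl -> gptq_direction kl ij.1 ij.2 = 0.
Proof.
have [LA A0 _] := revCholeskyP Apos; have [LB B0 _] := revCholeskyP Bpos.
rewrite gptq_directionE => /orP[lt|/andP[_ lt]].
  by rewrite [X in _ * X]normalized_inv_trig ?mulr0.
by rewrite normalized_inv_trig ?mul0r.
Qed.

(** Read at one entry, the product is a sum over all steps: the earlier ones account for the change
    of the working copy so far, the step of the entry itself has coefficient 1 and moves the copy
    onto [V], and the directions of the later ones vanish there. *)
Lemma gptq_errorE W :
  dequantize alpha beta (gptq rnd A B alpha beta W) - W =
  normalized_inv (revCholesky B) *m
  (\matrix_(i, j) (gptq_step_size (i, j) * rounding_error (gptq_input W (i, j))))
  *m (normalized_inv (revCholesky A))^T.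
Proof.
apply/matrixP => i j; rewrite !mxE gptqE.
pose ij := (i, j).
transitivity (\sum_kl (gptq_step_size kl * rounding_error (gptq_input W kl)) *
    gptq_direction kl i j); last first.
  under [RHS]eq_bigr do rewrite mxE mulr_suml.
  rewrite exchange_big pair_bigA/=; apply: eq_bigr => -[k l] _.
  by rewrite gptq_directionE/= !mxE; ring.
rewrite (bigID (fun kl => (gptq_rank kl < gptq_rank ij)%N))/=.
rewrite [X in _ = _ + X](bigD1 ij) ?ltnn//= (gptq_direction_diag ij) mulr1.
rewrite [X in _ = _ + (_ + X)]big1 ?addr0; last first.
  move=> kl; rewrite -leqNgt => /andP[le neq].
  rewrite (@gptq_direction_before ij kl) ?mulr0//; apply: gptq_rankP.
  by rewrite ltn_neqAle le andbT (inj_eq gptq_rank_inj) eq_sym.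
have inE : gptq_step_size ij * gptq_input W ij = W i j +
    \sum_(kl | (gptq_rank kl < gptq_rank ij)%N)
       gptq_step_size kl * rounding_error (gptq_input W kl) *
       gptq_direction kl i j.
  rewrite gptq_inputE mulrDr [_ * (_ / _)]mulrC divfK// mulr_sumr.
  congr (_ + _); apply: eq_bigr => kl _.
  by field; exact: step_size_neq0.
set S := \sum_(kl | _) _ in inE *.
by rewrite /rounding_error mulrBr inE /gptq_step_size/=; ring.
Qed.

End GPTQRecursion.

(** * Conditioning on the past *)

Section Conditioning.
Context {d : measure_display} {T : measurableType d} {R : realType}.
Variable P : probability T R.
Context {I : finType}.
Variable X : I -> {RV P >-> R}.
Implicit Types J : {set I}.

(** A family stable under intersection on which independence can be applied directly; uniqueness of
    measures extends the result to the generated sigma-algebra. *)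
Definition cylinder J : set (set T) :=
  [set A | exists2 E : I -> set R, (forall i, measurable (E i)) &
     A = \bigcap_(i in [set` J]) (X i @^-1` E i)].

(* The identity map from [T] to this coarser space plays the role of the vector
   of the variables with index in [J]. *)
Definition past J : measurableType (cylinder J).-sigma :=
  g_sigma_algebraType (cylinder J).

Lemma measurable_cylinder J : cylinder J `<=` measurable.
Proof.
move=> _ [E mE ->]; apply: fin_bigcap_measurable => [|i _]; first exact: finite_finset.
by rewrite -[X in measurable X]setTI; exact: measurable_funPT.
Qed.

Lemma cylinderI J : setI_closed (cylinder J).
Proof.
move=> _ _ [E mE ->] [F mF ->]; exists (fun i => E i `&` F i).
  by move=> i; exact: measurableI.
by rewrite -bigcapI.
Qed.

Lemma cylinderT J : cylinder J setT.
Proof.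
exists (fun=> setT) => //.
by apply/seteqP; split => // x _ i _.
Qed.

Lemma measurable_past J d' (S : measurableType d') (f : T -> S) :
  measurable_fun setT (f : past J -> S) -> measurable_fun setT f.
Proof.
move=> mf _ B mB; have := mf measurableT B mB.
by apply: smallest_sub; [exact: sigma_algebra_measurable|exact: measurable_cylinder].
Qed.

Lemma past_measurable_rv J i : i \in J ->
  measurable_fun setT (X i : past J -> R).
Proof.
move=> iJ _ B mB; apply: sub_sigma_algebra; rewrite setTI.
exists (fun j => if j == i then B else setT); first by move=> j; case: ifP.
apply/seteqP; split => x /= Bx; last by have := Bx i iJ; rewrite eqxx.
by move=> j _ /=; case: eqP => // ->.
Qed.

Definition to_past J (x : T) : past J := x.

Lemma measurable_to_past J : measurable_fun setT (to_past J).
Proof. by apply: (@measurable_past J) => //; exact: measurable_id. Qed.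

HB.instance Definition _ J :=
  isMeasurableFun.Build _ _ _ _ (to_past J) (@measurable_to_past J).

Definition past_rv J i (x : T) : past J * R := (to_past J x, X i x).

Lemma measurable_past_rv J i : measurable_fun setT (past_rv J i).
Proof. by apply: measurable_fun_pair. Qed.

HB.instance Definition _ J i :=
  isMeasurableFun.Build _ _ _ _ (past_rv J i) (@measurable_past_rv J i).

Hypothesis indep : mutually_independent P (fun i => X i : T -> R).

(** As functions of [A], both sides are finite measures, a restriction of [P] and a multiple of [P];
    they agree on cylinders, hence on the sigma-algebra these generate. *)
Lemma independent_past J i (A : set T) (B : set R) : i \notin J ->
  <<s cylinder J >> A -> measurable B ->
  P (A `&` X i @^-1` B) = (P A * P (X i @^-1` B))%E.
Proof.
move=> iJ JA mB.
have mXB : measurable (X i @^-1` B).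
  by rewrite -[X in measurable X]setTI; exact: measurable_funPT.
have p0 : 0 <= fine (P (X i @^-1` B)) by exact: fine_ge0.
pose r : {nonneg R} := NngNum p0.
have rE : r%:num%:E = P (X i @^-1` B) by rewrite /= fineK// fin_num_measure.
have := @g_sigma_algebra_measure_unique _ R T (cylinder J)
  (@measurable_cylinder J) (fun=> setT) (fun=> cylinderT J) _
  (mrestr P mXB) (mscale r P) (@cylinderI J) _ _ A JA.
rewrite /= /mrestr /mscale /= rE muleC; apply.
- by rewrite bigcup_const//; exists 0%N.
- move=> _ [E mE ->]; rewrite muleC.
  (* [E i] is arbitrary because [i] is not in [J]; putting [B] in that slot lets independence be
     used for [i |: J]. *)
  pose F j := if j == i then B else E j.
  have mF j : measurable (F j) by rewrite /F; case: ifP.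
  have EF : (\prod_(j in J) P (X j @^-1` E j) =
             \prod_(j in J) P (X j @^-1` F j))%E.
    apply: eq_bigr => j jJ; rewrite /F; case: eqP => // ji.
    by rewrite ji (negbTE iJ) in jJ.
  have /= := indep (i |: J) mF; rewrite big_setU1//= {2}/F eqxx -EF -indep// muleC.
  move=> <-; congr (P _); apply/seteqP; split => x.
    move=> [Ex Bx] j /=; rewrite !inE /F => /predU1P[->|jJ].
      by rewrite eqxx.
    by case: eqP => [->//|_]; exact: Ex.
  move=> Fx; split; last first.
    by have := Fx i; rewrite /= !inE eqxx /F eqxx; apply.
  move=> j jJ; have := Fx j; rewrite /= !inE jJ orbT /F => /(_ isT).
  by case: eqP => // ji; rewrite /= ji (negbTE iJ) in jJ.
- move=> _; rewrite setTI.
  by rewrite (le_lt_trans (probability_le1 _ _)) ?ltry.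
Qed.

(** By independence the joint law of the past and [X i] is a product measure, so Tonelli's theorem
    applies. *)
Lemma integral_past_rv J i (f : past J * R -> \bar R) : i \notin J ->
  measurable_fun setT f -> (forall x, 0 <= f x)%E ->
  (\int[P]_x f (past_rv J i x) =
   \int[distribution P (to_past J)]_y \int[distribution P (X i)]_w f (y, w))%E.
Proof.
move=> iJ mf f0.
pose Y : {RV P >-> (past J * R)%type} := past_rv J i.
rewrite -[LHS](ge0_integral_distribution Y mf f0).
rewrite -[RHS]fubini_tonelli1//; apply/esym/eq_measure_integral => A mA _.
apply: product_measure_unique => //= B C mB mC.
exact: (independent_past iJ mB mC).
Qed.

(** A substitute for conditional expectations: bounds that hold for each frozen value of [a] survive
    averaging against any nonnegative [h] that depends on the past. *)
Lemma expectation_past J i (a h : T -> R) (q : R -> R) (s l u : R) :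
  i \notin J -> measurable_fun setT (a : past J -> R) ->
  measurable_fun setT (h : past J -> R) -> measurable_fun setT q ->
  (forall x, 0 <= h x) -> (forall y, 0 <= q y) -> 0 <= l -> 0 <= u ->
  (forall x, l%:E <= \int[distribution P (X i)]_w (q (w / s + a x))%:E <= u%:E)%E ->
  (l%:E * \int[P]_x (h x)%:E <= \int[P]_x (h x * q (X i x / s + a x))%:E <=
   u%:E * \int[P]_x (h x)%:E)%E.
Proof.
move=> iJ ma mh mq h0 q0 l0 u0 lqu.
pose f (z : past J * R) : \bar R := (h z.1 * q (z.2 / s + a z.1))%:E.
have mf1 : measurable_fun setT (fun z : past J * R => z.2 / s + a z.1).
  apply: measurable_funD; first exact: measurable_funM.
  exact: (measurableT_comp ma).
have mf : measurable_fun setT f.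
  apply/measurable_EFinP; apply: measurable_funM.
    exact: (measurableT_comp mh).
  exact: (measurableT_comp mq).
have f0 z : (0 <= f z)%E by rewrite lee_fin mulr_ge0.
have mhE : measurable_fun setT (EFin \o (h : past J -> R)) by exact/measurable_EFinP.
have hE : (\int[P]_x (h x)%:E = \int[distribution P (to_past J)]_y (h y)%:E)%E.
  pose Y : {RV P >-> past J} := to_past J.
  by rewrite [RHS](ge0_integral_distribution Y mhE)// => y; rewrite lee_fin.
have inner y : (\int[distribution P (X i)]_w f (y, w) =
    (h y)%:E * \int[distribution P (X i)]_w (q (w / s + a y))%:E)%E.
  rewrite -ge0_integralZl//.
    apply/measurable_EFinP; apply: (measurableT_comp mq).
    by apply: measurable_funD => //; exact: measurable_funM.
  - by move=> w _; rewrite lee_fin.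
  - by rewrite lee_fin.
have := @measurable_fun_fubini_tonelli_F _ _ _ _ R (distribution P (X i)) f mf f0.
rewrite /fubini_F => mF.
have -> : (\int[P]_x (h x * q (X i x / s + a x))%:E =
    \int[distribution P (to_past J)]_y \int[distribution P (X i)]_w f (y, w))%E.
  by rewrite -integral_past_rv.
have h0E (y : past J) : (0 <= (h y)%:E)%E by rewrite lee_fin.
rewrite hE -!ge0_integralZl//.
apply/andP; split; apply: ge0_le_integral => //=.
- by move=> y _; rewrite -EFinM lee_fin mulr_ge0.
- by apply/measurable_EFinP; exact: measurable_funM.
- move=> y _; rewrite inner muleC lee_wpmul2l ?lee_fin//.
  by have /andP[] := lqu y.
- by move=> y _; apply: integral_ge0.
- by apply/measurable_EFinP; exact: measurable_funM.
- move=> y _; rewrite inner [leRHS]muleC lee_wpmul2l ?lee_fin//.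
  by have /andP[] := lqu y.
Qed.

End Conditioning.

(** * The normal distribution and rounding *)

(** The fibres are numbered by [pickle] to use countable additivity over the naturals; numbers that
    code no element give empty sets. *)
Lemma ge0_integral_fibers d (T : measurableType d) (R : realType)
    (mu : {measure set T -> \bar R}) (S : countType) (X : T -> S)
    (f : T -> \bar R) :
  (forall s, measurable (X @^-1` [set s])) ->
  measurable_fun setT f -> (forall x, 0 <= f x)%E ->
  (\int[mu]_x f x = \esum_(s in setT) \int[mu]_(x in X @^-1` [set s]) f x)%E.
Proof.
move=> mX mf f0; pose F k := (pickle \o X) @^-1` [set k].
have FE s : F (pickle s) = X @^-1` [set s].
  apply/seteqP; split => x; rewrite /F /=; last by move=> ->.
  by move/(pcan_inj pickleK).
have F0 k : (forall s : S, pickle s <> k) -> F k = set0.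
  by move=> ks; apply/seteqP; split => // x /= /ks.
have mF k : measurable (F k).
  have [[s <-]|ks] := pselect (exists s : S, pickle s = k); first by rewrite FE.
  by rewrite F0// => s ks'; apply: ks; exists s.
have UF : \bigcup_k F k = setT.
  by apply/seteqP; split => // x _; exists (pickle (X x)).
have tF : trivIset setT F by move=> i j _ _ [x [/= <- <-]].
rewrite -UF (ge0_integral_bigcup _ mF)//; last by rewrite UF.
rewrite nneseries_esumT; last by move=> k; exact: integral_ge0.
rewrite (esumID (range (@pickle S))); last by move=> k _; exact: integral_ge0.
rewrite [X in (_ + X)%E]esum1 ?adde0; last first.
  move=> k [_ /= ks]; rewrite F0 ?integral_set0// => s sk; apply: ks.
  by exists s.
rewrite setTI esum_image; last by move=> s t _ _ /(pcan_inj pickleK).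
by apply: eq_esum => s _; rewrite FE.
Qed.

(** * The second moment of the normal law *)

Section NormalMoments.
Context {R : realType}.
Local Notation mu := (@lebesgue_measure R).

Lemma ge0_integral_normal_prob (m s : R) (f : R -> \bar R) :
  measurable_fun setT f -> (forall x, 0 <= f x)%E ->
  (\int[normal_prob m s]_x f x = \int[mu]_x (f x * (normal_pdf m s x)%:E))%E.
Proof.
move=> mf f0; have dom := @normal_prob_dominates R m s.
rewrite -(Radon_Nikodym_SigmaFinite.change_of_variables dom)//.
have RNi := Radon_Nikodym_SigmaFinite.f_integrable dom.
have mpdf : measurable_fun setT (fun x => (normal_pdf m s x)%:E).
  by apply/measurable_EFinP; exact: measurable_normal_pdf.
apply: ae_eq_integral => //.
- by apply: emeasurable_funM => //; exact: measurable_int RNi.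
- exact: emeasurable_funM.
- apply: ae_eqe_mul2l; apply: integral_ae_eq => // E _ mE.
  by rewrite -Radon_Nikodym_SigmaFinite.f_integral.
Qed.

Lemma normal_pdf0E (s x : R) : 0 < s ->
  normal_pdf 0 s x = normal_peak s * expR (- x ^+ 2 / (s ^+ 2 *+ 2)).
Proof. by move=> s0; rewrite normal_pdfE ?gt_eqF// /normal_fun subr0. Qed.

Lemma normal_peakE (s : R) : 0 < s -> normal_peak s = (s * Num.sqrt (pi *+ 2))^-1.
Proof.
move=> s0; rewrite /normal_peak -mulrnAr sqrtrM ?sqr_ge0// sqrtr_sqr.
by rewrite gtr0_norm.
Qed.

(** Multiplying each density by its standard deviation equalizes the normalizing constants; what
    remains is [expR D >= 1 + D] for the difference [D] of the exponents. *)
Lemma normal_pdf_comparison (s t x : R) : 0 < s -> 0 < t ->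
  s * normal_pdf 0 s x * (1 + ((s ^+ 2)^-1 - (t ^+ 2)^-1) / 2 * x ^+ 2) <=
  t * normal_pdf 0 t x.
Proof.
move=> s0 t0; rewrite !normal_pdf0E// !normal_peakE//.
set c := Num.sqrt (pi *+ 2).
have c0 : 0 < c by rewrite sqrtr_gt0 mulrn_wgt0 ?pi_gt0.
have pk r y : 0 < r -> r * ((r * c)^-1 * y) = c^-1 * y.
  by move=> r0; field; rewrite !gt_eqF.
rewrite !pk//. rewrite -[leLHS]mulrA ler_pM2l ?invr_gt0//.
pose D := ((s ^+ 2)^-1 - (t ^+ 2)^-1) / 2 * x ^+ 2.
have -> : - x ^+ 2 / (t ^+ 2 *+ 2) = - x ^+ 2 / (s ^+ 2 *+ 2) + D.
  by rewrite /D; field; rewrite !gt_eqF.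
by rewrite expRD ler_wpM2l ?expR_ge0// expR_ge1Dx.
Qed.

Lemma integral_mul_normal_pdf (k s : R) : 0 <= k ->
  (\int[mu]_x (k * normal_pdf 0 s x)%:E = k%:E)%E.
Proof.
move=> k0; under eq_integral do rewrite EFinM.
rewrite ge0_integralZl//; first by rewrite integral_normal_pdf mule1.
- by apply/measurable_EFinP; exact: measurable_normal_pdf.
- by move=> x _; rewrite lee_fin normal_pdf_ge0.
Qed.

(* Integrating [normal_pdf_comparison] for [t] above and below [s] and letting [t]
   tend to [s] avoids an improper integration by parts. *)
Lemma normal_second_moment_pdf (s : R) : 0 < s ->
  (\int[mu]_x (x ^+ 2 * normal_pdf 0 s x)%:E = (s ^+ 2)%:E)%E.
Proof.
move=> s0; set v := (LHS).
have v0 : (0 <= v)%E.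
  by apply: integral_ge0 => x _; rewrite lee_fin mulr_ge0 ?sqr_ge0 ?normal_pdf_ge0.
have mx2 : measurable_fun setT (fun x : R => x ^+ 2 * normal_pdf 0 s x).
  by apply: measurable_funM; [exact: exprn_measurable|exact: measurable_normal_pdf].
have mpdf t : measurable_fun setT (fun x : R => t * normal_pdf 0 t x).
  by apply: measurable_funM => //; exact: measurable_normal_pdf.
have p0 t x : 0 < t -> 0 <= t * normal_pdf 0 t x.
  by move=> t0; rewrite mulr_ge0 ?normal_pdf_ge0// ltW.
have x20 x : 0 <= x ^+ 2 * normal_pdf 0 s x.
  by rewrite mulr_ge0 ?sqr_ge0 ?normal_pdf_ge0.
have sumE k t : 0 <= k -> 0 < t ->
    (\int[mu]_x (t * normal_pdf 0 t x + k * (x ^+ 2 * normal_pdf 0 s x))%:E =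
     t%:E + k%:E * v)%E.
  move=> k0 t0; under eq_integral do rewrite EFinD.
  rewrite ge0_integralD//; last 4 first.
  - by move=> x _; rewrite lee_fin p0.
  - by apply/measurable_EFinP; exact: mpdf.
  - by move=> x _; rewrite lee_fin mulr_ge0.
  - by apply/measurable_EFinP; exact: measurable_funM.
  rewrite integral_mul_normal_pdf ?ltW//; congr (_ + _)%E.
  under eq_integral do rewrite EFinM.
  rewrite ge0_integralZl//; first exact/measurable_EFinP.
  by move=> x _; rewrite lee_fin.
have up t : s < t -> (v <= (t ^+ 2)%:E)%E.
  move=> st; have t0 : 0 < t by exact: lt_trans st.
  (* The coefficient of [x ^+ 2] in the comparison, whose integral reads [s + a v <= t]. Since
     [a t ^+ 2] exceeds [t - s] by a square, [v <= t ^+ 2] follows. *)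
  pose a := s * (((s ^+ 2)^-1 - (t ^+ 2)^-1) / 2).
  have a0 : 0 < a.
    rewrite mulr_gt0// divr_gt0// subr_gt0 ltf_pV2 ?posrE ?exprn_gt0//.
    by rewrite ltr_pXn2r// nnegrE ltW.
  have : (s%:E + a%:E * v <= t%:E)%E.
    rewrite -(sumE _ _ (ltW a0) s0) -[leRHS](integral_mul_normal_pdf t (ltW t0)).
    apply: ge0_le_integral => //.
    + by move=> x _; rewrite lee_fin addr_ge0 ?p0// mulr_ge0// ltW.
    + apply/measurable_EFinP; apply: measurable_funD; first exact: mpdf.
      exact: measurable_funM.
    + by apply/measurable_EFinP; exact: mpdf.
    + move=> x _; rewrite lee_fin; apply: le_trans (normal_pdf_comparison x s0 t0).
      by rewrite /a le_eqVlt; apply/orP; left; apply/eqP; ring.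
  case: v v0 {sumE} => [r _|_|//]; last by rewrite gt0_muley.
  rewrite -EFinM -EFinD !lee_fin => H; rewrite leNgt; apply/negP => tr.
  have : a * t ^+ 2 < a * r by rewrite ltr_pM2l.
  have -> : a * t ^+ 2 = (t - s) + (t - s) ^+ 2 / (2 * s).
    by rewrite /a; field; rewrite !gt_eqF.
  have : 0 <= (t - s) ^+ 2 / (2 * s) by rewrite divr_ge0 ?sqr_ge0// mulr_ge0 ?ltW.
  by lra.
have low t : 0 < t -> t < s -> ((t ^+ 2)%:E <= v)%E.
  move=> t0 ts.
  pose a := s * (((t ^+ 2)^-1 - (s ^+ 2)^-1) / 2).
  have a0 : 0 < a.
    rewrite mulr_gt0// divr_gt0// subr_gt0 ltf_pV2 ?posrE ?exprn_gt0//.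
    by rewrite ltr_pXn2r// nnegrE ltW.
  have : (s%:E <= t%:E + a%:E * v)%E.
    rewrite -(sumE _ _ (ltW a0) t0) -[leLHS](integral_mul_normal_pdf s (ltW s0)).
    apply: ge0_le_integral => //.
    + by move=> x _; rewrite lee_fin p0.
    + by apply/measurable_EFinP; exact: mpdf.
    + apply/measurable_EFinP; apply: measurable_funD; first exact: mpdf.
      exact: measurable_funM.
    + move=> x _; rewrite lee_fin -lerBlDr.
      apply: le_trans (normal_pdf_comparison x s0 t0).
      by rewrite /a le_eqVlt; apply/orP; left; apply/eqP; ring.
  case: v v0 {sumE up} => [r _|_ _|//]; last by rewrite leey.
  rewrite -EFinM -EFinD !lee_fin => H; rewrite -(ler_pM2l a0).
  have -> : a * t ^+ 2 = (s - t) - (s - t) ^+ 2 / (2 * s).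
    by rewrite /a; field; rewrite !gt_eqF.
  have : 0 <= (s - t) ^+ 2 / (2 * s) by rewrite divr_ge0 ?sqr_ge0// mulr_ge0 ?ltW.
  by lra.
have s1 : s < s + 1 by rewrite ltrDl.
case: v v0 up low {sumE} => [r r0|_ /(_ _ s1)//|//] up low.
rewrite lee_fin in r0; congr EFin; apply/eqP; rewrite eq_le.
(* If [r] and [s ^+ 2] differed, the [t] whose square is their midpoint would contradict [up] or
   [low]. *)
have tE : 0 <= (r + s ^+ 2) / 2 by rewrite divr_ge0// addr_ge0// sqr_ge0.
have sE : s = Num.sqrt (s ^+ 2) by rewrite sqrtr_sqr gtr0_norm.
have s20 : 0 < s ^+ 2 by rewrite exprn_gt0.
apply/andP; split; rewrite leNgt; apply/negP => H.
  have /up : s < Num.sqrt ((r + s ^+ 2) / 2) by rewrite [X in X < _]sE ltr_sqrt; lra.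
  by rewrite sqr_sqrtr// lee_fin; lra.
have := low (Num.sqrt ((r + s ^+ 2) / 2)); rewrite sqrtr_gt0 sqr_sqrtr// lee_fin.
have -> : 0 < (r + s ^+ 2) / 2 by lra.
move=> /(_ isT); rewrite [X in _ < X]sE ltr_sqrt// => H'.
suff : (r + s ^+ 2) / 2 <= r by lra.
by apply: H'; lra.
Qed.

Lemma normal_second_moment (s : R) : 0 < s ->
  (\int[normal_prob 0 s]_x (x ^+ 2)%:E = (s ^+ 2)%:E)%E.
Proof.
move=> s0; rewrite ge0_integral_normal_prob.
- by rewrite -normal_second_moment_pdf//; apply: eq_integral => x _.
- by apply/measurable_EFinP; exact: exprn_measurable.
- by move=> x; rewrite lee_fin sqr_ge0.
Qed.

End NormalMoments.

(** * Rounding errors on the cells of a shifted grid *)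

Section Rounding.
Context {R : realType} (rnd : R -> int).
Hypothesis rnd_nearest : nearest_integer rnd.
Local Notation mu := (@lebesgue_measure R).
Local Notation err := (rounding_error rnd).

Lemma normr_rounding_error (y : R) : `|err y| <= 2^-1.
Proof. by rewrite /rounding_error distrC; exact: rnd_nearest. Qed.

Lemma rnd_eq (z : int) (y : R) :
  z%:~R - 2^-1 < y < z%:~R + 2^-1 -> rnd y = z.
Proof.
move=> /andP[zy yz]; have := rnd_nearest y; rewrite ler_norml => /andP[ry yr].
apply/eqP; rewrite eq_le -!ltzD1 -!(ltr_int R) !rmorphD/=.
by apply/andP; split; lra.
Qed.

Lemma rnd_fiber_itv (z : int) :
  rnd @^-1` [set z] `<=` `[z%:~R - 2^-1, z%:~R + 2^-1].
Proof.
move=> y /= yz; have := rnd_nearest y; rewrite yz in_itv/= ler_norml.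
by move=> /andP[? ?]; apply/andP; split; lra.
Qed.

(** Although [rnd] is arbitrary at ties, a fibre is an open interval plus some subset of its two
    endpoints. *)
Lemma measurable_rnd_fiber (z : int) : measurable (rnd @^-1` [set z]).
Proof.
pose a : R := z%:~R - 2^-1; pose b : R := z%:~R + 2^-1.
have -> : rnd @^-1` [set z] =
    `]a, b[%classic `|` (rnd @^-1` [set z] `&` [set a; b]).
  apply/seteqP; split => y; last first.
    by move=> [|[]//]; rewrite /= in_itv/= => /rnd_eq.
  move=> yz; have := rnd_fiber_itv yz; rewrite /= !in_itv/= !le_eqVlt.
  move=> /andP[/predU1P[ay|ay] /predU1P[yb|yb]].
  - by right; split => //; left.
  - by right; split => //; left.
  - by right; split => //; right.
  - by left; rewrite ay yb.
apply: measurableU => //; apply: countable_measurable => [t|].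
  exact: measurable_set1.
by apply: finite_set_countable; apply: finite_setIr; exact: finite_set2.
Qed.

Lemma measurable_rnd : measurable_fun setT (fun y : R => (rnd y)%:~R : R).
Proof.
move=> _ B mB; rewrite setTI.
have -> : (fun y : R => (rnd y)%:~R : R) @^-1` B =
    \bigcup_(z : int) (if (z%:~R : R) \in B then rnd @^-1` [set z] else set0).
  apply/seteqP; split => y /=.
    by move=> By; exists (rnd y) => //; rewrite mem_set.
  by move=> [z _]; case: ifPn => //; rewrite inE => Bz /= ->.
apply: countable_bigcupT_measurable => [|z]; first exact: countableP.
by case: ifP => // _; exact: measurable_rnd_fiber.
Qed.

Lemma measurable_rounding_error : measurable_fun setT err.
Proof. by apply: measurable_funB => //; exact: measurable_rnd. Qed.

Lemma integral_deriv_poly (p : {poly R}) (a b : R) : a < b ->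
  (\int[mu]_(x in `[a, b]) (p^`().[x])%:E = (p.[b] - p.[a])%:E)%E.
Proof.
move=> ab; rewrite (@continuous_FTC2 _ (horner p^`()) (horner p))//.
- by apply: continuous_subspaceT; exact: continuous_horner.
- split=> [x _||]; first exact: derivable_horner.
  + by apply: cvg_at_right_filter; exact: continuous_horner.
  + by apply: cvg_at_left_filter; exact: continuous_horner.
- by move=> x _; rewrite derivE.
Qed.

Section Quadratic.
Variables c0 c1 c2 : R.
Let p (u : R) := c0 + c1 * u + c2 * u ^+ 2.

(** The origin of the factor 1/12: under the uniform law on [-1/2, 1/2] the linear term averages to
    0 and the square to 1/12. The polynomial [P] is a primitive of the integrand. *)
Lemma integral_centered_quadratic (x0 s : R) : 0 < s ->
  (\int[mu]_(w in `[(x0 - s / 2)%R, (x0 + s / 2)%R]) (p ((x0 - w) / s))%:E =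
   (s * (c0 + c2 / 12))%:E)%E.
Proof.
move=> s0; pose X0 : {poly R} := 'X - x0%:P.
pose P : {poly R} := c0 *: X0 - (c1 / (2 * s)) *: X0 ^+ 2
                     + (c2 / (3 * s ^+ 2)) *: X0 ^+ 3.
have PE w : p ((x0 - w) / s) = P^`().[w].
  rewrite /P !derivD derivN !derivZ !deriv_exp derivXsubC /X0 /= !mul1r alg_polyC.
  rewrite !(hornerD, hornerN, hornerZ, hornerMn, horner_exp, hornerX, hornerC).
  by rewrite /p; field; rewrite gt_eqF.
have h : x0 - s / 2 < x0 + s / 2 by lra.
transitivity (\int[mu]_(w in `[(x0 - s / 2)%R, (x0 + s / 2)%R]) (P^`().[w])%:E)%E.
  by apply: eq_integral => w _; rewrite PE.
rewrite integral_deriv_poly//; congr EFin.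
rewrite /P /X0 !(hornerD, hornerN, hornerZ, horner_exp, hornerX, hornerC).
by field; rewrite gt_eqF.
Qed.

(** Up to endpoints, the set of [w] with [rnd (w / s + b) = z]. Half-open intervals tile the line
    exactly, however [rnd] breaks ties. *)
Definition cell (s b : R) (z : int) : set R :=
  `[s * (z%:~R - b) - s / 2, s * (z%:~R - b) + s / 2[%classic.

Lemma cell_interior (s b : R) (z : int) (w : R) : 0 < s ->
  w \in `]s * (z%:~R - b) - s / 2, s * (z%:~R - b) + s / 2[ ->
  rnd (w / s + b) = z.
Proof.
move=> s0; rewrite in_itv/= => /andP[lw wr]; apply: rnd_eq.
rewrite -ltrBlDr ltr_pdivlMr// -ltrBrDr ltr_pdivrMr//.
by apply/andP; split; lra.
Qed.

Lemma integral_cell_rounding_error (s b : R) (z : int) : 0 < s ->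
  (\int[mu]_(w in cell s b z) (p (err (w / s + b)))%:E =
   (s * (c0 + c2 / 12))%:E)%E.
Proof.
move=> s0; set x0 := s * (z%:~R - b).
have mp (f : R -> R) D : measurable_fun setT f ->
    measurable_fun D (fun w => p (f w)).
  move=> mf; apply: measurable_funTS; rewrite /p.
  apply: measurable_funD; last first.
    by apply: measurable_funM => //; exact: measurable_funX.
  by apply: measurable_funD => //; exact: measurable_funM.
rewrite -(integral_centered_quadratic x0)// -integral_itv_bndo_bndc; last first.
  apply/measurable_EFinP; apply: mp.
  by apply: measurable_funM => //; exact: measurable_funB.
apply: eq_integral_itv_bounded.
- apply: mp; apply: (measurableT_comp measurable_rounding_error).
  by apply: measurable_funD => //; exact: measurable_funM.
- apply: mp.
  by apply: measurable_funM => //; exact: measurable_funB.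
- move=> w /(cell_interior s0) wz; rewrite /rounding_error wz; congr p.
  by rewrite /x0; field; rewrite gt_eqF.
Qed.

End Quadratic.

(** This exhibits the cells as the fibres of one integer-valued function, so that
    [ge0_integral_fibers] can split integrals over them. *)
Lemma cell_fiber (s b : R) (z : int) : 0 < s ->
  (fun w : R => Num.floor (w / s + b + 2^-1)) @^-1` [set z] = cell s b z.
Proof.
move=> s0; apply/seteqP; split=> w; rewrite /cell /= in_itv/=.
  move=> <-; set f := Num.floor _; have := floor_itv (w / s + b + 2^-1).
  rewrite -/f rmorphD/= => /andP[].
  have -> : w / s + b + 2^-1 = (w + s * b + s / 2) / s.
    by field; rewrite gt_eqF.
  rewrite ler_pdivlMr// ltr_pdivrMr// => l r.
  by apply/andP; split; lra.
move=> /andP[l r]; apply/eqP; rewrite floor_eq rmorphD/=.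
have -> : w / s + b + 2^-1 = (w + s * b + s / 2) / s.
  by field; rewrite gt_eqF.
by rewrite ler_pdivlMr// ltr_pdivrMr//; apply/andP; split; lra.
Qed.

End Rounding.

Lemma lebesgue_measure_centered_itv {R : realType} (x0 s : R) (b0 b1 : bool) :
  0 < s -> lebesgue_measure
    [set` Interval (BSide b0 (x0 - s / 2)) (BSide b1 (x0 + s / 2))] = s%:E.
Proof.
move=> s0; rewrite lebesgue_measure_itv/= lte_fin.
have -> : x0 - s / 2 < x0 + s / 2 by lra.
by rewrite -EFinB; congr EFin; lra.
Qed.

(** * Rounding a normal variable with a small step *)

Section NormalRounding.
Context {R : realType} (rnd : R -> int).
Hypothesis rnd_nearest : nearest_integer rnd.
Variables (sigma s : R).
Hypotheses (sigma_gt0 : 0 < sigma) (s_gt0 : 0 < s).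
Local Notation mu := (@lebesgue_measure R).
Local Notation err := (rounding_error rnd).

(* The normal density at distance [s] further away from the mean: a lower
   bound for the density on any interval of length [s] containing [w]. *)
Definition shifted_pdf (w : R) : R :=
  normal_peak sigma * expR (- (`|w| + s) ^+ 2 / (sigma ^+ 2 *+ 2)).

Lemma shifted_pdf_ge0 w : 0 <= shifted_pdf w.
Proof. by rewrite mulr_ge0 ?normal_peak_ge0 ?expR_ge0. Qed.

Lemma measurable_shifted_pdf : measurable_fun setT shifted_pdf.
Proof.
apply: measurable_funM => //; apply: (measurableT_comp (@measurable_expR R)).
apply: measurable_funM => //; apply: measurableT_comp => //.
by apply: measurable_funX; apply: measurable_funD.
Qed.

(** The mass lost from the normal density to [shifted_pdf] is at most the mean of the drop
    [(2 s |w| + s ^+ 2) / (2 sigma ^+ 2)] in the exponent; [2 |w| <= 1 + w ^+ 2] reduces this mean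
    to a second moment. *)
Definition rounding_defect : R :=
  (s ^+ 2 + s * (1 + sigma ^+ 2)) / (2 * sigma ^+ 2).

Lemma integral_shifted_pdf :
  ((1 - rounding_defect)%:E <= \int[mu]_w (shifted_pdf w)%:E)%E.
Proof.
(* The relative loss at [x] is at most [k + l * x ^+ 2], whose mean is [rounding_defect]. *)
pose k := (s ^+ 2 + s) / (2 * sigma ^+ 2); pose l := s / (2 * sigma ^+ 2).
have k0 : 0 <= k by rewrite divr_ge0 ?mulr_ge0 ?addr_ge0 ?sqr_ge0// ltW.
have l0 : 0 <= l by rewrite divr_ge0 ?mulr_ge0 ?sqr_ge0// ltW.
have x20 (x : R) : 0 <= x ^+ 2 * normal_pdf 0 sigma x.
  by rewrite mulr_ge0 ?sqr_ge0 ?normal_pdf_ge0.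
have mx2 : measurable_fun setT (fun x : R => x ^+ 2 * normal_pdf 0 sigma x).
  by apply: measurable_funM; [exact: exprn_measurable|exact: measurable_normal_pdf].
have mpdf : measurable_fun setT (fun x : R => k * normal_pdf 0 sigma x).
  by apply: measurable_funM => //; exact: measurable_normal_pdf.
have mx2l : measurable_fun setT (fun x : R => l * (x ^+ 2 * normal_pdf 0 sigma x)).
  exact: measurable_funM.
pose f (x : R) := k * normal_pdf 0 sigma x + l * (x ^+ 2 * normal_pdf 0 sigma x).
have mf : measurable_fun setT f by apply: measurable_funD; [exact: mpdf|exact: mx2l].
have f0 x : 0 <= f x by rewrite addr_ge0// mulr_ge0// normal_pdf_ge0.
have intf : (\int[mu]_x (f x)%:E = rounding_defect%:E)%E.
  under eq_integral do rewrite EFinD.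
  rewrite ge0_integralD//; last 4 first.
  - by move=> x _; rewrite lee_fin mulr_ge0 ?normal_pdf_ge0.
  - by apply/measurable_EFinP; exact: mpdf.
  - by move=> x _; rewrite lee_fin mulr_ge0.
  - by apply/measurable_EFinP; exact: mx2l.
  rewrite integral_mul_normal_pdf//.
  under eq_integral do rewrite EFinM.
  rewrite ge0_integralZl//; last 2 first.
  - by apply/measurable_EFinP; exact: mx2.
  - by move=> x _; rewrite lee_fin.
  rewrite normal_second_moment_pdf// -EFinM -EFinD; congr EFin.
  by rewrite /k /l /rounding_defect; field; rewrite gt_eqF.
rewrite EFinB leeBlDr// -intf -ge0_integralD//; last 4 first.
- by move=> x _; rewrite lee_fin shifted_pdf_ge0.
- by apply/measurable_EFinP; exact: measurable_shifted_pdf.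
- by move=> x _; rewrite lee_fin.
- by apply/measurable_EFinP; exact: mf.
rewrite -(integral_normal_pdf 0 sigma); apply: ge0_le_integral => //.
- by move=> x _; rewrite lee_fin normal_pdf_ge0.
- by apply/measurable_EFinP; exact: measurable_normal_pdf.
- apply/measurable_EFinP; apply: measurable_funD; last exact: mf.
  exact: measurable_shifted_pdf.
move=> x _; rewrite -EFinD lee_fin /f normal_pdf0E//.
pose D := ((`|x| + s) ^+ 2 - x ^+ 2) / (sigma ^+ 2 *+ 2).
have -> : shifted_pdf x =
    normal_peak sigma * (expR (- x ^+ 2 / (sigma ^+ 2 *+ 2)) * expR (- D)).
  rewrite -expRD /shifted_pdf; congr (_ * expR _).
  by rewrite /D; field; rewrite gt_eqF.
set p := normal_peak sigma; set e := expR (- x ^+ 2 / _).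
have pe0 : 0 <= p * e by rewrite mulr_ge0 ?normal_peak_ge0 ?expR_ge0.
have : D <= k + l * x ^+ 2.
  have -> : k + l * x ^+ 2 = (s ^+ 2 + s * (1 + x ^+ 2)) / (sigma ^+ 2 *+ 2).
    by rewrite /k /l; field; rewrite gt_eqF.
  rewrite ler_pM2r ?invr_gt0 ?mulrn_wgt0 ?exprn_gt0//.
  have H : 0 <= s * (`|x| - 1) ^+ 2 by rewrite mulr_ge0 ?sqr_ge0// ltW.
  rewrite -(real_normK (num_real x)).
  by rewrite -subr_ge0 (_ : _ - _ = s * (`|x| - 1) ^+ 2)//; ring.
move=> Dkl; have eD := expR_ge1Dx (- D).
have -> : k * (p * e) + l * (x ^+ 2 * (p * e)) = p * e * (k + l * x ^+ 2) by ring.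
rewrite [p * (e * _)]mulrA -mulrDr -[leLHS]mulr1.
by rewrite ler_wpM2l//; lra.
Qed.

Section Quadratic.
Variables c0 c1 c2 : R.
Let p (u : R) := c0 + c1 * u + c2 * u ^+ 2.
Hypothesis p_ge0 : forall u, `|u| <= 2^-1 -> 0 <= p u.

Lemma measurable_quadratic_error (b : R) :
  measurable_fun setT (fun w : R => p (err (w / s + b))).
Proof.
have me : measurable_fun setT (fun w : R => err (w / s + b)).
  apply: (measurableT_comp (measurable_rounding_error rnd_nearest)).
  by apply: measurable_funD => //; exact: measurable_funM.
apply: measurable_funD; last first.
  by apply: measurable_funM => //; exact: measurable_funX.
by apply: measurable_funD => //; exact: measurable_funM.
Qed.

Lemma quadratic_mean_ge0 : 0 <= c0 + c2 / 12.
Proof.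
have : (0 <= \int[mu]_(w in cell s 0 0) (p (err (w / s + 0)))%:E)%E.
  by apply: integral_ge0 => w _; rewrite lee_fin p_ge0// normr_rounding_error.
by rewrite integral_cell_rounding_error// lee_fin pmulr_rge0.
Qed.

(** On each cell a constant [h] separates [shifted_pdf], below it, from the normal density, above
    it. The integral of [p] over a cell being exact, summation over the cells leaves the mass of
    [shifted_pdf], whatever the shift [b]. *)
Lemma normal_rounding_lb (b : R) :
  (((1 - rounding_defect) * (c0 + c2 / 12))%:E <=
   \int[normal_prob 0 sigma]_w (p (err (w / s + b)))%:E)%E.
Proof.
have q0 w : 0 <= p (err (w / s + b)) by rewrite p_ge0// normr_rounding_error.
have mq := measurable_quadratic_error b.
have mean0 := quadratic_mean_ge0.
rewrite ge0_integral_normal_prob//; last 1 first.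
- by apply/measurable_EFinP; exact: mq.
apply: (@le_trans _ _ (\int[mu]_w ((c0 + c2 / 12) * shifted_pdf w)%:E)%E).
  under eq_integral do rewrite EFinM.
  rewrite ge0_integralZl//; last 2 first.
  - by apply/measurable_EFinP; exact: measurable_shifted_pdf.
  - by move=> w _; rewrite lee_fin shifted_pdf_ge0.
  rewrite mulrC EFinM lee_wpmul2l ?lee_fin//; exact: integral_shifted_pdf.
have mcell (z : int) : measurable (cell s b z) by exact: measurable_itv.
have mfib (z : int) :
    measurable ((fun w : R => Num.floor (w / s + b + 2^-1)) @^-1` [set z]).
  by rewrite cell_fiber.
have mpdf : measurable_fun setT (fun w : R =>
    p (err (w / s + b)) * normal_pdf 0 sigma w).
  by apply: measurable_funM => //; exact: measurable_normal_pdf.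
have mlow : measurable_fun setT (fun w : R => (c0 + c2 / 12) * shifted_pdf w).
  by apply: measurable_funM => //; exact: measurable_shifted_pdf.
rewrite (ge0_integral_fibers mu mfib); last 2 first.
- by apply/measurable_EFinP; exact: mlow.
- by move=> w; rewrite lee_fin mulr_ge0// shifted_pdf_ge0.
rewrite [leRHS](ge0_integral_fibers mu mfib); last 2 first.
- by apply/measurable_EFinP; exact: mpdf.
- by move=> w; rewrite lee_fin mulr_ge0 ?normal_pdf_ge0.
apply: le_esum => z _; rewrite cell_fiber//.
set x0 := s * (z%:~R - b).
(* The distance from 0 to the farther endpoint, so that [|w| <= M <= |w| + s] on the cell. *)
pose M : R := Num.max `|x0 - s / 2| `|x0 + s / 2|.
have M0 : 0 <= M by rewrite le_max normr_ge0.
pose h := normal_peak sigma * expR (- M ^+ 2 / (sigma ^+ 2 *+ 2)).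
have h0 : 0 <= h by rewrite mulr_ge0 ?normal_peak_ge0 ?expR_ge0.
have lenE : mu (cell s b z) = s%:E.
  exact: lebesgue_measure_centered_itv.
have twosq : 0 < sigma ^+ 2 *+ 2 by rewrite mulrn_wgt0 ?exprn_gt0.
apply: (@le_trans _ _ (h * (s * (c0 + c2 / 12)))%:E).
  apply: (@le_trans _ _ (\int[mu]_(w in cell s b z) (((c0 + c2 / 12) * h)%:E))%E).
    apply: ge0_le_integral => //.
    - exact: mcell.
    - by move=> w _; rewrite lee_fin mulr_ge0// shifted_pdf_ge0.
    - by apply: measurable_funTS; apply/measurable_EFinP; exact: mlow.
    move=> w; rewrite /cell/= in_itv/= -/x0 => /andP[lw wr].
    rewrite lee_fin ler_wpM2l// ler_wpM2l ?normal_peak_ge0// ler_expR.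
    rewrite ler_pM2r ?invr_gt0// lerN2 ler_pXn2r ?nnegrE ?addr_ge0 ?(ltW s_gt0)//.
    rewrite ge_max !ler_norml; have w1 := ler_norm w.
    have w2 := ler_norm (- w); rewrite normrN in w2.
    by apply/andP; split; apply/andP; split; lra.
  rewrite integral_cst; last exact: mcell.
  rewrite [X in (_ * X)%E](_ : _ = s%:E)// -EFinM lee_fin le_eqVlt.
  by apply/orP; left; apply/eqP; ring.
rewrite EFinM -(integral_cell_rounding_error rnd_nearest c0 c1 c2 b z s_gt0).
rewrite -ge0_integralZl//; last 2 first.
- by apply: measurable_funTS; apply/measurable_EFinP; exact: mq.
- by move=> w _; rewrite lee_fin; exact: q0.
apply: ge0_le_integral => //.
- exact: mcell.
- by move=> w _; rewrite -EFinM lee_fin mulr_ge0//; exact: q0.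
- apply: measurable_funTS; apply/measurable_EFinP.
  by apply: measurable_funM => //; exact: mq.
- by apply: measurable_funTS; apply/measurable_EFinP; exact: mpdf.
move=> w; rewrite /cell/= in_itv/= -/x0 => /andP[lw wr].
rewrite -EFinM lee_fin [leLHS]mulrC ler_wpM2l ?(q0 w)// normal_pdf0E//.
rewrite ler_wpM2l ?normal_peak_ge0// ler_expR ler_pM2r ?invr_gt0// lerN2.
rewrite -(real_normK (num_real w)) ler_pXn2r ?nnegrE//.
rewrite le_max !ler_norml.
have [x00|x00] := leP 0 x0.
  apply/orP; right; have := ler_norm (x0 + s / 2) => H.
  by apply/andP; split; lra.
apply/orP; left; have := ler_norm (- (x0 - s / 2)); rewrite normrN => H.
by apply/andP; split; lra.
exact: mcell.
Qed.

End Quadratic.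

(** The set of [w] rounded to [z] lies between an open and a closed interval of the same length
    [s]. *)
Lemma normal_rounding_fiber (b l u : R) (z : int) :
  (forall w, s * (z%:~R - b) - s / 2 <= w <= s * (z%:~R - b) + s / 2 ->
     l <= normal_pdf 0 sigma w <= u) -> 0 <= l ->
  ((s * l)%:E <= \int[normal_prob 0 sigma]_w
     (\1_(rnd @^-1` [set z]) (w / s + b) : R)%:E <= (s * u)%:E)%E.
Proof.
move=> lu l0; set x0 := s * (z%:~R - b) in lu.
pose A := (fun w : R => w / s + b) @^-1` (rnd @^-1` [set z]).
have mA : measurable A.
  rewrite -[X in measurable X]setTI.
  have : measurable_fun setT (fun w : R => w / s + b).
    by apply: measurable_funD => //; exact: measurable_funM.
  by apply => //; exact: measurable_rnd_fiber.
have -> : (\int[normal_prob 0 sigma]_w (\1_(rnd @^-1` [set z]) (w / s + b) : R)%:E =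
    normal_prob 0 sigma A)%E.
  by rewrite -[A in RHS]setIT -integral_indic.
rewrite /normal_prob.
have inA (w : R) : x0 - s / 2 < w < x0 + s / 2 -> A w.
  by move=> H; apply: (@cell_interior _ rnd rnd_nearest _ _ z w s_gt0);
    rewrite in_itv/=.
have Asub w : A w -> x0 - s / 2 <= w <= x0 + s / 2.
  move=> /(rnd_fiber_itv rnd_nearest); rewrite /= in_itv/=.
  move=> /andP[].
  have -> : w / s + b = (w + s * b) / s by field; rewrite gt_eqF.
  rewrite ler_pdivlMr// ler_pdivrMr// /x0 => ? ?.
  by apply/andP; split; lra.
have len b0 b1 :
    mu [set` Interval (BSide b0 (x0 - s / 2)) (BSide b1 (x0 + s / 2))] = s%:E.
  exact: lebesgue_measure_centered_itv.
have mpdf D : measurable_fun D (fun w : R => (normal_pdf 0 sigma w)%:E).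
  by apply: measurable_funTS; apply/measurable_EFinP; exact: measurable_normal_pdf.
apply/andP; split.
  apply: (@le_trans _ _ (\int[mu]_(w in `](x0 - s / 2)%R, (x0 + s / 2)%R[) l%:E)%E).
    by rewrite integral_cst// [X in (_ * X)%E]len -EFinM lee_fin mulrC.
  apply: (@le_trans _ _
    (\int[mu]_(w in `](x0 - s / 2)%R, (x0 + s / 2)%R[) (normal_pdf 0 sigma w)%:E)%E).
    apply: ge0_le_integral => //; first exact: mpdf.
    move=> w; rewrite /= in_itv/= => /andP[lw wr].
    by rewrite lee_fin; have /lu /andP[] : x0 - s / 2 <= w <= x0 + s / 2 by rewrite !ltW.
  apply: ge0_subset_integral => //; first exact: mpdf.
    by move=> w _; rewrite lee_fin normal_pdf_ge0.
apply: (@le_trans _ _ (\int[mu]_(w in `[(x0 - s / 2)%R, (x0 + s / 2)%R])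
    (normal_pdf 0 sigma w)%:E)%E).
  apply: ge0_subset_integral => //; first exact: mpdf.
    by move=> w _; rewrite lee_fin normal_pdf_ge0.
apply: (@le_trans _ _ (\int[mu]_(w in `[(x0 - s / 2)%R, (x0 + s / 2)%R]) u%:E)%E).
  apply: ge0_le_integral => //.
  - by move=> w _; rewrite lee_fin normal_pdf_ge0.
  - exact: mpdf.
  - by move=> w; rewrite /= in_itv/= lee_fin => /lu /andP[].
by rewrite integral_cst// [X in (_ * X)%E]len -EFinM lee_fin mulrC.
Qed.

End NormalRounding.

(** * Quantization with feedback *)

Section FiniteSums.
Context {d : measure_display} {T : measurableType d} {R : realType}.
Variables (mu : {measure set T -> \bar R}) (I : finType) (f : I -> T -> R).
Hypothesis fi : forall i, mu.-integrable setT (EFin \o f i).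

Lemma integrable_fin_sum :
  mu.-integrable setT (EFin \o (fun w => \sum_i f i w)).
Proof.
rewrite (_ : _ \o _ = (fun w => \sum_i (EFin \o f i) w)%E).
  by apply: integrable_sum => // i _; exact: fi.
by apply/funext => w /=; rewrite sumEFin.
Qed.

Lemma Rintegral_fin_sum :
  \int[mu]_w (\sum_i f i w) = \sum_i \int[mu]_w f i w.
Proof.
rewrite /Rintegral; under eq_integral do rewrite -sumEFin.
rewrite integral_sum//= (eq_bigr (fun i => (\int[mu]_w f i w)%:E)).
  by rewrite sumEFin.
by move=> i _; rewrite /Rintegral fineK//; exact: integrable_fin_num (fi i).
Qed.

End FiniteSums.

Section EntropyIntegral.
Context {d : measure_display} {T : measurableType d} {R : realType}.
Variable P : probability T R.
Variables (S : countType) (Z : T -> S).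
Hypothesis mZ : forall a, measurable (Z @^-1` [set a]).

Lemma measurable_countable_comp (g : S -> R) :
  measurable_fun setT (fun w => g (Z w)).
Proof.
move=> _ B mB; rewrite setTI (_ : _ @^-1` _ =
  \bigcup_(a : S) (if g a \in B then Z @^-1` [set a] else set0)).
  apply: countable_bigcupT_measurable => [|a]; first exact: countableP.
  by case: ifP.
apply/seteqP; split => w /=.
  by move=> Bw; exists (Z w) => //; rewrite mem_set.
by move=> [a _]; case: ifPn => //; rewrite inE => Ba /= ->.
Qed.

Let prob a : R := fine (P (Z @^-1` [set a])).

Let prob_fin a : P (Z @^-1` [set a]) = (prob a)%:E.
Proof. by rewrite fineK//; exact: fin_num_measure. Qed.

Let prob_le1 a : prob a <= 1.
Proof. by rewrite -lee_fin -prob_fin probability_le1. Qed.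

(** The self-information is nonnegative and constant on each fibre. In this form, pointwise bounds
    on it can be integrated directly. *)
Lemma entropy_integral :
  entropy P Z = (\int[P]_w (- log2 (prob (Z w)))%:E)%E.
Proof.
have l0 a : 0 <= - log2 (prob a).
  by rewrite /log2 -mulNr divr_ge0 ?ln_ge0 ?ler1n// oppr_ge0 ln_le0.
rewrite (ge0_integral_fibers P mZ); last 2 first.
- apply/measurable_EFinP.
  exact: (@measurable_countable_comp (fun a => - log2 (prob a))).
- by move=> w; rewrite lee_fin.
apply: eq_esum => a _.
rewrite (eq_integral (fun=> (- log2 (prob a))%:E)); last first.
  by move=> w; rewrite inE => /= ->.
rewrite integral_cst; last exact: mZ.
rewrite [X in (_ * X)%E](_ : _ = (prob a)%:E); last exact: prob_fin.
by rewrite -EFinM mulNr mulrC.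
Qed.

End EntropyIntegral.

Section FeedbackQuantizer.
Context {d : measure_display} {T : measurableType d} {R : realType}.
Variable P : probability T R.
Context {I : finType}.
Variable X : I -> {RV P >-> R}.
Variable sigma : R.
Hypothesis sigma_gt0 : 0 < sigma.
Hypothesis X_law : forall i (E : set R), measurable E ->
  distribution P (X i) E = normal_prob 0 sigma E.
Hypothesis X_indep : mutually_independent P (fun i => X i : T -> R).

Let rv_borel i (w : T) : measurableTypeR R := X i w.

Let measurable_rv_borel i : measurable_fun setT (rv_borel i).
Proof. exact: (measurable_funP (X i)). Qed.

HB.instance Definition _ i :=
  isMeasurableFun.Build _ _ _ _ (rv_borel i) (@measurable_rv_borel i).

(* The two sides live on two copies of the Borel space of [R], with different
   displays, whence the detour by an integral over [T]. *)
Lemma integral_normal_law i (f : R -> \bar R) :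
  measurable_fun setT f -> (forall y, 0 <= f y)%E ->
  (\int[distribution P (X i)]_y f y = \int[normal_prob 0 sigma]_y f y)%E.
Proof.
move=> mf f0; rewrite ge0_integral_distribution//.
pose Y : {RV P >-> measurableTypeR R} := rv_borel i.
rewrite -[LHS](@ge0_integral_distribution _ _ _ _ _ P Y f)//.
by apply: eq_measure_integral => A mA _; exact: X_law.
Qed.

Variable rnd : R -> int.
Hypothesis rnd_nearest : nearest_integer rnd.
Variables (rank : I -> nat) (rank_inj : injective rank).
Variables (c : I -> I -> R) (s : I -> R).
Hypothesis s_gt0 : forall i, 0 < s i.
Local Notation err := (rounding_error rnd).

Variable x : I -> T -> R.
Hypothesis xE : forall i w, x i w =
  X i w / s i + \sum_(k | (rank k < rank i)%N) c i k * err (x k w).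

Definition strict_past i : {set I} := [set k | (rank k < rank i)%N].

Definition feedback i (w : T) : R :=
  \sum_(k | (rank k < rank i)%N) c i k * err (x k w).

Lemma feedback_mkcond i : feedback i = (fun w =>
  \sum_k (if (rank k < rank i)%N then c i k * err (x k w) else 0)).
Proof. by apply/funext => w; rewrite /feedback big_mkcond. Qed.

(** A crude bound valid for all entries at once, with 1/2 the largest rounding error. It involves
    [c] but not the steps [s], so it does not change with gamma. *)
Definition feedback_bound : R := (\sum_i \sum_k `|c i k|) / 2.

Lemma feedback_bound_ge0 : 0 <= feedback_bound.
Proof. by rewrite divr_ge0// sumr_ge0// => i _; exact: sumr_ge0. Qed.

Lemma normr_feedback i w : `|feedback i w| <= feedback_bound.
Proof.
apply: (le_trans (ler_norm_sum _ _ _)).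
rewrite /feedback_bound [in leRHS](bigD1 i)//= mulrDl ler_wpDr//.
  by rewrite divr_ge0// sumr_ge0// => k _; exact: sumr_ge0.
rewrite mulr_suml [leRHS](bigID (fun k => (rank k < rank i)%N))/= ler_wpDr//.
  by apply: sumr_ge0 => k _; rewrite divr_ge0.
apply: ler_sum => k _; rewrite normrM ler_wpM2l//.
exact: normr_rounding_error.
Qed.

Lemma past_measurable_sum (J : {set I}) i :
  (forall k, (rank k < rank i)%N -> measurable_fun setT (x k : past X J -> R)) ->
  measurable_fun setT (feedback i : past X J -> R).
Proof.
move=> mx; rewrite feedback_mkcond; apply: measurable_sum => k.
case ki: (rank k < rank i)%N; last exact: measurable_cst.
apply: measurable_funM; first exact: measurable_cst.
by apply: (measurableT_comp (measurable_rounding_error rnd_nearest)); exact: mx.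
Qed.

(** Strong induction on the rank: an input involves its own variable and the errors of lower rank
    only. *)
Lemma past_measurable_input_le (J : {set I}) i :
  (forall k, (rank k <= rank i)%N -> k \in J) ->
  measurable_fun setT (x i : past X J -> R).
Proof.
have [n] := ubnP (rank i); elim: n i => // n IH i; rewrite ltnS => ni iJ.
rewrite (_ : x i = fun w => X i w / s i + feedback i w); last first.
  by apply/funext => w; rewrite xE.
apply: measurable_funD.
  by apply: measurable_funM => //; apply: past_measurable_rv; exact: iJ.
apply: past_measurable_sum => k ki; apply: IH; first exact: leq_trans ki ni.
by move=> l lk; apply: iJ; rewrite (leq_trans lk)// ltnW.
Qed.

Lemma past_measurable_feedback i :
  measurable_fun setT (feedback i : past X (strict_past i) -> R).
Proof.
apply: past_measurable_sum => k ki; apply: past_measurable_input_le => l lk.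
by rewrite inE (leq_ltn_trans lk).
Qed.

Lemma past_measurable_input i k : (rank k < rank i)%N ->
  measurable_fun setT (x k : past X (strict_past i) -> R).
Proof.
move=> ki; apply: past_measurable_input_le => l lk.
by rewrite inE (leq_ltn_trans lk).
Qed.

Lemma measurable_input i : measurable_fun setT (x i).
Proof.
apply: (@measurable_past _ _ _ P _ X [set: I]).
by apply: past_measurable_input_le => k _; rewrite inE.
Qed.

Lemma measurable_input_error i : measurable_fun setT (fun w => err (x i w)).
Proof.
apply: (measurableT_comp (measurable_rounding_error rnd_nearest)).
exact: measurable_input.
Qed.

(** With the past frozen, the input is a scaled normal variable plus a number [b], so it is enough
    to bound the integral of [q] for every [b] that the feedback can take. *)
Lemma expectation_step i (h : T -> R) (q : R -> R) (l u : R) :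
  measurable_fun setT (h : past X (strict_past i) -> R) ->
  measurable_fun setT q -> (forall w, 0 <= h w) -> (forall y, 0 <= q y) ->
  0 <= l -> 0 <= u ->
  (forall b, `|b| <= feedback_bound ->
    (l%:E <= \int[normal_prob 0 sigma]_w (q (w / s i + b))%:E <= u%:E)%E) ->
  (l%:E * \int[P]_w (h w)%:E <= \int[P]_w (h w * q (x i w))%:E <=
   u%:E * \int[P]_w (h w)%:E)%E.
Proof.
move=> mh mq h0 q0 l0 u0 lqu.
have iJ : i \notin strict_past i by rewrite inE ltnn.
have -> : (\int[P]_w (h w * q (x i w))%:E =
           \int[P]_w (h w * q (X i w / s i + feedback i w))%:E)%E.
  by apply: eq_integral => w _; rewrite xE.
apply: (expectation_past X_indep iJ (@past_measurable_feedback i)) => // w.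
rewrite integral_normal_law; first exact/lqu/normr_feedback.
  apply/measurable_EFinP; apply: (measurableT_comp mq).
  by apply: measurable_funD => //; exact: measurable_funM.
by move=> y; rewrite lee_fin.
Qed.

(** * First and second moments of the rounding errors *)

Section Correlations.
Variable e : R.
Hypothesis e_le1 : e <= 1.
Hypothesis defect_le : forall i, rounding_defect sigma (s i) <= e.

Lemma bounded_integrable (f : T -> R) (M : R) : measurable_fun setT f ->
  (forall w, `|f w| <= M) -> P.-integrable setT (EFin \o f).
Proof.
move=> mf fM; apply: measurable_bounded_integrable => //.
  by rewrite (le_lt_trans (probability_le1 _ _)) ?ltry.
by exists M; split=> [|N MN w _]; [exact: num_real|exact: le_trans (fM w) (ltW MN)].
Qed.

(** The weight [h] carries the past: [h = 1] gives the moments of one error, and an affine function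
    of an earlier error gives the correlations. *)
Lemma expectation_quadratic_lb i (h : T -> R) (M c0 c1 c2 : R) :
  measurable_fun setT (h : past X (strict_past i) -> R) ->
  (forall w, 0 <= h w <= M) ->
  (forall u, `|u| <= 2^-1 -> 0 <= c0 + c1 * u + c2 * u ^+ 2) ->
  (1 - e) * (c0 + c2 / 12) * (\int[P]_w h w) <=
  \int[P]_w (h w * (c0 + c1 * err (x i w) + c2 * err (x i w) ^+ 2)).
Proof.
move=> mh hM p0; have h0 w : 0 <= h w by have /andP[] := hM w.
have mean0 := quadratic_mean_ge0 rnd_nearest (s_gt0 i) p0.
have pe (y : R) : `|c0 + c1 * err y + c2 * err y ^+ 2| <= `|c0| + `|c1| + `|c2|.
  have e1 : `|err y| <= 1.
    by rewrite (le_trans (normr_rounding_error rnd_nearest y))//; lra.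
  rewrite (le_trans (ler_normD _ _))// lerD//.
    by rewrite (le_trans (ler_normD _ _))// lerD// normrM ler_piMr.
  by rewrite normrM ler_piMr// normrX exprn_ile1.
have mp : measurable_fun setT (fun y => c0 + c1 * err y + c2 * err y ^+ 2).
  have me := measurable_rounding_error rnd_nearest.
  apply: measurable_funD; last first.
    by apply: measurable_funM => //; exact: measurable_funX.
  by apply: measurable_funD => //; exact: measurable_funM.
have mh' := measurable_past mh.
have mhp : measurable_fun setT
    (fun w => h w * (c0 + c1 * err (x i w) + c2 * err (x i w) ^+ 2)).
  apply: measurable_funM => //; apply: (measurableT_comp mp).
  exact: measurable_input.
have le1 : 0 <= (1 - e) * (c0 + c2 / 12).
  by rewrite mulr_ge0// subr_ge0.
have u0 : 0 <= `|c0| + `|c1| + `|c2| by rewrite !addr_ge0.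
have := @expectation_step i h (fun y => c0 + c1 * err y + c2 * err y ^+ 2)
  ((1 - e) * (c0 + c2 / 12)) (`|c0| + `|c1| + `|c2|) mh mp h0.
have q0 y : 0 <= c0 + c1 * err y + c2 * err y ^+ 2.
  by rewrite p0// normr_rounding_error.
move=> /(_ q0 le1 u0) H.
have hi : P.-integrable setT (EFin \o h).
  by apply: (@bounded_integrable _ M) => // w; rewrite ger0_norm//; have /andP[] := hM w.
have hpi : P.-integrable setT (EFin \o (fun w =>
    h w * (c0 + c1 * err (x i w) + c2 * err (x i w) ^+ 2))).
  apply: (@bounded_integrable _ (M * (`|c0| + `|c1| + `|c2|))) => // w.
  by rewrite normrM ler_pM// ger0_norm//; have /andP[] := hM w.
have fin1 := integrable_fin_num measurableT hi.
have fin2 := integrable_fin_num measurableT hpi.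
rewrite -lee_fin /Rintegral EFinM !fineK//.
suff /H/andP[] : forall b, `|b| <= feedback_bound ->
    (((1 - e) * (c0 + c2 / 12))%:E <= \int[normal_prob 0 sigma]_w
       (c0 + c1 * err (w / s i + b) + c2 * err (w / s i + b) ^+ 2)%:E <=
     (`|c0| + `|c1| + `|c2|)%:E)%E by [].
move=> b _; apply/andP; split.
  apply: le_trans (normal_rounding_lb rnd_nearest sigma_gt0 (s_gt0 i) p0 b).
  by rewrite lee_fin ler_wpM2r// lerB.
rewrite -[leRHS]mule1 -[X in (_ * X)%E](probability_setT (normal_prob 0 sigma)).
rewrite -integral_cst//; apply: ge0_le_integral => //.
- by move=> w _; rewrite lee_fin.
- apply/measurable_EFinP; apply: (measurableT_comp mp).
  by apply: measurable_funD => //; exact: measurable_funM.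
- by move=> w _; rewrite lee_fin (le_trans (ler_norm _)).
Qed.

Let u i w := err (x i w).

Lemma integrable_input_error i : P.-integrable setT (EFin \o u i).
Proof.
apply: (@bounded_integrable _ 2^-1); first exact: measurable_input_error.
by move=> w; exact: normr_rounding_error.
Qed.

Lemma integrable_past_input_error i (h : T -> R) (M : R) :
  measurable_fun setT (h : past X (strict_past i) -> R) ->
  (forall w, 0 <= h w <= M) ->
  P.-integrable setT (EFin \o (fun w => h w * u i w)).
Proof.
move=> mh hM; apply: (@bounded_integrable _ (M * 2^-1)).
  by apply: measurable_funM; [exact: measurable_past mh|exact: measurable_input_error].
move=> w; have /andP[h0 hM'] := hM w; rewrite normrM ler_pM//.
  by rewrite ger0_norm.
exact: normr_rounding_error.
Qed.

(** The lower bound for [1/2 + u] and [1/2 - u], both of uniform mean 1/2, bounds the mean of [h u]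
    from below and from above. *)
Lemma expectation_past_error i (h : T -> R) (M : R) :
  measurable_fun setT (h : past X (strict_past i) -> R) ->
  (forall w, 0 <= h w <= M) ->
  `|\int[P]_w (h w * u i w)| <= e / 2 * \int[P]_w h w.
Proof.
move=> mh hM; have hui := integrable_past_input_error mh hM.
have hi : P.-integrable setT (EFin \o h).
  apply: (@bounded_integrable _ M); first exact: measurable_past mh.
  by move=> w; have /andP[? ?] := hM w; rewrite ger0_norm.
have p1 (v : R) : `|v| <= 2^-1 -> 0 <= 2^-1 + 1 * v + 0 * v ^+ 2.
  by rewrite ler_norml => /andP[? ?]; lra.
have p2 (v : R) : `|v| <= 2^-1 -> 0 <= 2^-1 + - 1 * v + 0 * v ^+ 2.
  by rewrite ler_norml => /andP[? ?]; lra.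
have hh : P.-integrable setT (EFin \o (fun w => 2^-1 * h w)).
  exact: (integrableZl measurableT (2^-1) hi).
have H1 := expectation_quadratic_lb mh hM p1.
have H2 := expectation_quadratic_lb mh hM p2.
have E1 : \int[P]_w (h w * (2^-1 + 1 * err (x i w) + 0 * err (x i w) ^+ 2)) =
    2^-1 * \int[P]_w h w + \int[P]_w (h w * u i w).
  rewrite -RintegralZl// -RintegralD//; apply: eq_Rintegral => w _.
  by rewrite /u; ring.
have E2 : \int[P]_w (h w * (2^-1 + - 1 * err (x i w) + 0 * err (x i w) ^+ 2)) =
    2^-1 * \int[P]_w h w - \int[P]_w (h w * u i w).
  rewrite -RintegralZl// -RintegralB//; apply: eq_Rintegral => w _.
  by rewrite /u; ring.
rewrite E1 in H1; rewrite E2 in H2.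
set a := \int[P]_w h w in H1 H2 *; set b := \int[P]_w _ in H1 H2 *.
by rewrite ler_norml; apply/andP; split; lra.
Qed.

Lemma Rintegral_prob_cst (r : R) : \int[P]_w (cst r w) = r.
Proof.
rewrite Rintegral_cst; last exact: measurableT.
transitivity (r * 1); last by rewrite mulr1.
by congr (_ * _); exact: (congr1 fine (@probability_setT _ _ _ P)).
Qed.

Lemma expectation_input_error i : `|\int[P]_w u i w| <= e / 2.
Proof.
have := @expectation_past_error i (cst 1) 1.
rewrite Rintegral_prob_cst mulr1 => H.
rewrite (_ : \int[P]_w u i w = \int[P]_w (cst 1 w * u i w)).
  by apply: H => [|w]; [exact: measurable_cst|rewrite /= ler01 lexx].
by apply: eq_Rintegral => w _; rewrite mul1r.
Qed.

(** The same device with the quadratics [u ^+ 2] and [1/4 - u ^+ 2], whose uniform means are 1/12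
    and 1/6. *)
Lemma expectation_sqr_error i : `|\int[P]_w (u i w * u i w) - 12^-1| <= e.
Proof.
have m1 : measurable_fun setT (cst 1 : past X (strict_past i) -> R).
  exact: measurable_cst.
have b1 (w : T) : 0 <= (cst 1 w : R) <= 1 by rewrite /= ler01 lexx.
have p1 (v : R) : `|v| <= 2^-1 -> 0 <= 0 + 0 * v + 1 * v ^+ 2.
  by move=> _; rewrite mul0r !add0r mul1r sqr_ge0.
have p2 (v : R) : `|v| <= 2^-1 -> 0 <= 4^-1 + 0 * v + - 1 * v ^+ 2.
  move=> v2; have : `|v| ^+ 2 <= 2^-1 ^+ 2.
    by rewrite ler_pXn2r// nnegrE.
  by rewrite real_normK ?num_real// => ?; lra.
have H1 := expectation_quadratic_lb m1 b1 p1.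
have H2 := expectation_quadratic_lb m1 b1 p2.
rewrite Rintegral_prob_cst in H1; rewrite Rintegral_prob_cst in H2.
have uui : P.-integrable setT (EFin \o (fun w => u i w * u i w)).
  apply: (@bounded_integrable _ (2^-1 * 2^-1)).
    by apply: measurable_funM; exact: measurable_input_error.
  by move=> w; rewrite normrM ler_pM//; exact: normr_rounding_error.
have ci : P.-integrable setT (EFin \o (cst (4^-1 : R) : T -> R)).
  by apply: (@bounded_integrable _ `|4^-1|) => //; exact: measurable_cst.
have E1 : \int[P]_w (cst 1 w * (0 + 0 * err (x i w) + 1 * err (x i w) ^+ 2)) =
    \int[P]_w (u i w * u i w).
  by apply: eq_Rintegral => w _; rewrite /u/=; ring.
have E2 : \int[P]_w (cst 1 w * (4^-1 + 0 * err (x i w) + - 1 * err (x i w) ^+ 2)) =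
    4^-1 - \int[P]_w (u i w * u i w).
  rewrite -[in RHS](Rintegral_prob_cst 4^-1) -RintegralB//.
  by apply: eq_Rintegral => w _; rewrite /u/=; ring.
rewrite E1 in H1; rewrite E2 in H2.
set b := \int[P]_w _ in H1 H2 *.
(* The sign of [e] is recovered from an estimate in which it bounds an absolute value. *)
have e0 : 0 <= e / 2 := le_trans (normr_ge0 _) (expectation_input_error i).
by rewrite ler_norml; apply/andP; split; lra.
Qed.

(** The earlier error has no sign, so it is shifted to [h = 1/2 + u k], with values in [0, 1]; the
    shift is paid for by the mean of [u i], which is small as well. *)
Lemma expectation_cross_error i k : (rank k < rank i)%N ->
  `|\int[P]_w (u k w * u i w)| <= e.
Proof.
move=> ki; pose h w := 2^-1 + u k w.
have mh : measurable_fun setT (h : past X (strict_past i) -> R).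
  apply: measurable_funD; first exact: measurable_cst.
  apply: (measurableT_comp (measurable_rounding_error rnd_nearest)).
  exact: past_measurable_input.
have hM w : 0 <= h w <= 1.
  have := normr_rounding_error rnd_nearest (x k w).
  by rewrite ler_norml -/(u k w) /h => /andP[? ?]; apply/andP; split; lra.
have Hh := expectation_past_error mh hM.
have Hu := expectation_input_error i.
have uki : P.-integrable setT (EFin \o (fun w => u k w * u i w)).
  apply: (@bounded_integrable _ (2^-1 * 2^-1)).
    by apply: measurable_funM; exact: measurable_input_error.
  by move=> w; rewrite normrM ler_pM//; exact: normr_rounding_error.
have ui := integrable_input_error i; have uk := integrable_input_error k.
have ui2 : P.-integrable setT (EFin \o (fun w => 2^-1 * u i w)).
  exact: (integrableZl measurableT (2^-1) ui).
have ci : P.-integrable setT (EFin \o (cst (2^-1 : R) : T -> R)).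
  by apply: (@bounded_integrable _ `|2^-1|) => //; exact: measurable_cst.
have E1 : \int[P]_w (h w * u i w) =
    2^-1 * \int[P]_w u i w + \int[P]_w (u k w * u i w).
  rewrite -RintegralZl// -RintegralD//; apply: eq_Rintegral => w _.
  by rewrite /h; ring.
have E2 : \int[P]_w (h w) = 2^-1 + \int[P]_w u k w.
  by rewrite -[in RHS](Rintegral_prob_cst 2^-1) -RintegralD.
have h1 : \int[P]_w h w <= 1.
  rewrite E2; have := expectation_input_error k.
  by rewrite ler_norml => /andP[_]; move: e_le1; set a := \int[P]_w _; lra.
have e0 : 0 <= e / 2 := le_trans (normr_ge0 _) Hu.
have : e / 2 * \int[P]_w h w <= e / 2 by rewrite ler_piMr//; lra.
rewrite E1 in Hh; move: Hh Hu; rewrite !ler_norml.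
set a := \int[P]_w u i w; set b := \int[P]_w (u k w * u i w).
by move=> /andP[? ?] /andP[? ?] ?; apply/andP; split; lra.
Qed.

Lemma expectation_error_product i k :
  `|\int[P]_w (u i w * u k w) - (i == k)%:R / 12| <= e.
Proof.
have [ik|ki|ik] := ltngtP (rank i) (rank k).
- by rewrite (_ : i == k = false) ?mul0r ?subr0 ?expectation_cross_error//;
    apply: contraTF ik => /eqP ->; rewrite ltnn.
- rewrite (_ : i == k = false) ?mul0r ?subr0; last first.
    by apply: contraTF ki => /eqP ->; rewrite ltnn.
  under eq_Rintegral do rewrite mulrC.
  exact: expectation_cross_error.
- by rewrite (rank_inj ik) eqxx mul1r; exact: expectation_sqr_error.
Qed.

End Correlations.

(** * The probability of a given integer output, and the entropy *)

Local Notation fb := feedback_bound.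
(** In units of the step, the largest possible distance between the variable and the integer that
    encodes it: feedback plus rounding error. *)
Let radius : R := fb + 2^-1.

(** The extreme values of the density within [radius] steps of [s i * z]. They depend on [z] alone;
    the truncation in [pdf_ub] covers the integers whose range reaches the mean 0. *)
Let pdf_lb i (z : int) : R :=
  normal_peak sigma *
  expR (- (s i * (`|z%:~R| + radius)) ^+ 2 / (sigma ^+ 2 *+ 2)).

Let pdf_ub i (z : int) : R :=
  normal_peak sigma *
  expR (- Num.max 0 (s i * (`|z%:~R| - radius)) ^+ 2 / (sigma ^+ 2 *+ 2)).

Let pdf_bounds i (z : int) (b w : R) : `|b| <= fb ->
  s i * (z%:~R - b) - s i / 2 <= w <= s i * (z%:~R - b) + s i / 2 ->
  pdf_lb i z <= normal_pdf 0 sigma w <= pdf_ub i z.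
Proof.
move=> bfb /andP[lw wr]; have si := s_gt0 i.
have twosq : 0 < sigma ^+ 2 *+ 2 by rewrite mulrn_wgt0 ?exprn_gt0.
have dist : `|w - s i * z%:~R| <= s i * radius.
  have : `|s i * b| <= s i * fb by rewrite normrM gtr0_norm// ler_pM2l.
  rewrite !ler_norml /radius => /andP[? ?]; apply/andP; split; lra.
have r0 : 0 <= radius by rewrite addr_ge0 ?feedback_bound_ge0.
have zE : `|s i * z%:~R| = s i * `|z%:~R| by rewrite normrM gtr0_norm.
rewrite normal_pdf0E// -(real_normK (num_real w)); apply/andP; split.
  rewrite ler_wpM2l ?normal_peak_ge0// ler_expR ler_pM2r ?invr_gt0// lerN2.
  rewrite ler_pXn2r ?nnegrE ?mulr_ge0 ?(addr_ge0 (normr_ge0 _) r0) ?(ltW si)//.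
  rewrite mulrDr -zE; apply: le_trans (lerD (lexx _) dist).
  by rewrite addrC; have := ler_normD (w - s i * z%:~R) (s i * z%:~R); rewrite subrK.
rewrite ler_wpM2l ?normal_peak_ge0// ler_expR ler_pM2r ?invr_gt0// lerN2.
rewrite ler_pXn2r ?nnegrE ?le_max ?lexx// ge_max normr_ge0/= mulrBr -zE lerBlDr.
apply: le_trans (lerD (lexx _) dist); rewrite distrC.
by have := ler_normD w (s i * z%:~R - w); rewrite addrC subrK.
Qed.

Section CellProbability.
Variable z : I -> int.

Definition prefix_event t : set T :=
  [set w | forall i, (rank i < t)%N -> rnd (x i w) = z i].

Lemma prefix_eventE t : prefix_event t =
  \bigcap_(i in [set i | (rank i < t)%N]) (x i @^-1` (rnd @^-1` [set z i])).
Proof. by []. Qed.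

Lemma measurable_prefix_event i :
  measurable (prefix_event (rank i) : set (past X (strict_past i))).
Proof.
rewrite prefix_eventE; apply: fin_bigcap_measurable => [|k /= ki].
  exact: finite_finset.
rewrite -[Y in measurable Y]setTI.
apply: (past_measurable_input ki) => //.
exact: measurable_rnd_fiber.
Qed.

(** This is [expectation_step] for two indicators, [h] of the integers already prescribed and [q] of
    the next one. *)
Lemma prefix_event_prob_step i :
  ((s i * pdf_lb i (z i))%:E * P (prefix_event (rank i)) <=
     P (prefix_event (rank i).+1) <=
   (s i * pdf_ub i (z i))%:E * P (prefix_event (rank i)))%E.
Proof.
pose h : T -> R := \1_(prefix_event (rank i)).
pose q : R -> R := \1_(rnd @^-1` [set z i]).
have mE := measurable_prefix_event (i := i).
have mE' : measurable (prefix_event (rank i)).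
  rewrite prefix_eventE; apply: fin_bigcap_measurable => [|k /= ki].
    exact: finite_finset.
  rewrite -[Y in measurable Y]setTI.
  apply: (@measurable_input _) => //.
  exact: measurable_rnd_fiber.
have mh : measurable_fun setT (h : past X (strict_past i) -> R).
  exact: (@measurable_indic _ (past X (strict_past i)) R setT).
have mq : measurable_fun setT q by apply: measurable_indic; exact: measurable_rnd_fiber.
have h0 w : 0 <= h w by [].
have q0 y : 0 <= q y by [].
have lb0 : 0 <= pdf_lb i (z i) by rewrite mulr_ge0 ?normal_peak_ge0 ?expR_ge0.
have ub0 : 0 <= pdf_ub i (z i) by rewrite mulr_ge0 ?normal_peak_ge0 ?expR_ge0.
have := expectation_step
  (l := s i * pdf_lb i (z i)) (u := s i * pdf_ub i (z i)) mh mq h0 q0.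
have -> : (\int[P]_w (h w)%:E = P (prefix_event (rank i)))%E.
  by rewrite integral_indic// setIT.
have -> : (\int[P]_w (h w * q (x i w))%:E = P (prefix_event (rank i).+1))%E.
  have -> : prefix_event (rank i).+1 =
      prefix_event (rank i) `&` (x i @^-1` (rnd @^-1` [set z i])).
    apply/seteqP; split=> w /=.
      by move=> H; split=> [k ki|]; apply: H => //; rewrite ltnS// ltnW.
    move=> [H1 H2] k; rewrite ltnS leq_eqVlt => /predU1P[/rank_inj -> //|].
    exact: H1.
  have mxi : measurable (x i @^-1` (rnd @^-1` [set z i])).
    rewrite -[Y in measurable Y]setTI.
    apply: (@measurable_input _) => //.
    exact: measurable_rnd_fiber.
  rewrite -[in RHS](setIT (prefix_event _ `&` _)) -integral_indic//; last first.
    exact: measurableI.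
  by apply: eq_integral => w _; rewrite indicI.
have si0 := ltW (s_gt0 i).
apply; [exact: mulr_ge0|exact: mulr_ge0|] => b bfb.
by apply: normal_rounding_fiber => // w; exact: pdf_bounds.
Qed.

Lemma prefix_event_prob t :
  ((\prod_(i | (rank i < t)%N) (s i * pdf_lb i (z i)))%:E <=
     P (prefix_event t) <=
   (\prod_(i | (rank i < t)%N) (s i * pdf_ub i (z i)))%:E)%E.
Proof.
have lb0 i : 0 <= s i * pdf_lb i (z i).
  by rewrite mulr_ge0 ?(ltW (s_gt0 i))// mulr_ge0 ?normal_peak_ge0 ?expR_ge0.
have ub0 i : 0 <= s i * pdf_ub i (z i).
  by rewrite mulr_ge0 ?(ltW (s_gt0 i))// mulr_ge0 ?normal_peak_ge0 ?expR_ge0.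
elim: t => [|t /andP[IHl IHu]].
  rewrite !big_pred0// (_ : prefix_event 0 = setT).
    by have := @probability_setT _ _ _ P; rewrite /= => ->; rewrite lexx.
  exact/seteqP.
(* Ranks are only known to be injective, so [t] may be the rank of no index; the event and both
   products then stay the same. *)
have [[i it]|none] := pselect (exists i, rank i = t); last first.
  have rkS k : (rank k < t.+1)%N = (rank k < t)%N.
    rewrite ltnS leq_eqVlt; case: eqP => //= kt.
    by exfalso; apply: none; exists k.
  rewrite !(eq_bigl _ _ rkS) (_ : prefix_event t.+1 = prefix_event t) ?IHl//.
  by apply/seteqP; split => w /= H k kt; apply: H; rewrite ?rkS// -rkS.
have rkS k : (rank k < t.+1)%N = (k == i) || (rank k < t)%N.
  by rewrite ltnS leq_eqVlt -[in Y in _ == Y]it (inj_eq rank_inj).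
have split_prod (f : I -> R) :
    \prod_(k | (rank k < t.+1)%N) f k = f i * \prod_(k | (rank k < t)%N) f k.
  rewrite (eq_bigl _ _ rkS) (bigD1 i)/= ?eqxx//; congr (_ * _).
  apply: eq_bigl => k; case: eqVneq => [->|]//=; last by rewrite andbT.
  by rewrite it ltnn.
rewrite !split_prod !EFinM; have := prefix_event_prob_step i; rewrite it.
move=> /andP[l u]; apply/andP; split.
  by apply: le_trans l; rewrite lee_wpmul2l ?lee_fin.
by apply: (le_trans u); rewrite lee_wpmul2l ?lee_fin.
Qed.

Lemma cell_prob :
  ((\prod_i (s i * pdf_lb i (z i)))%:E <=
     P [set w | forall i, rnd (x i w) = z i] <=
   (\prod_i (s i * pdf_ub i (z i)))%:E)%E.
Proof.
pose t := (\max_i rank i).+1.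
have rk i : (rank i < t)%N by rewrite ltnS (leq_bigmax i).
have := prefix_event_prob t; rewrite !(eq_bigl _ _ rk).
rewrite (_ : prefix_event t = [set w | forall i, rnd (x i w) = z i])//.
by apply/seteqP; split => w /= H i => [|_]; exact: H.
Qed.

End CellProbability.

Variables (S : countType) (Z : T -> S) (decode : S -> I -> int).
Hypothesis decode_inj : forall a b, decode a =1 decode b -> a = b.
Hypothesis ZE : forall w i, decode (Z w) i = rnd (x i w).

Let ZfiberE a : Z @^-1` [set a] = [set w | forall i, rnd (x i w) = decode a i].
Proof.
apply/seteqP; split => w /=; first by move=> <- i; rewrite ZE.
by move=> H; apply: decode_inj => i; rewrite ZE.
Qed.

Lemma measurable_quantizer_fiber a : measurable (Z @^-1` [set a]).
Proof.
rewrite ZfiberE (_ : [set w | _] =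
    \bigcap_(i in [set: I]) (x i @^-1` (rnd @^-1` [set decode a i]))); last first.
  by apply/seteqP; split => w /= H i => [_|]; exact: H.
apply: fin_bigcap_measurable => [|i _]; first exact: finite_finset.
rewrite -[Y in measurable Y]setTI; apply: (@measurable_input _) => //.
exact: measurable_rnd_fiber.
Qed.

Let logterm i : R := - ln (s i * normal_peak sigma).

Let peak_gt0 i : 0 < s i * normal_peak sigma.
Proof. by rewrite mulr_gt0// normal_peak_gt0// gt_eqF. Qed.

Let prod_pdfE (y : I -> R) :
  \prod_i (s i * (normal_peak sigma * expR (- y i))) =
  expR (- \sum_i (logterm i + y i)).
Proof.
rewrite -sumrN expR_sum; apply: eq_bigr => i _.
by rewrite opprD expRD /logterm opprK lnK ?posrE// mulrA.
Qed.

Let twosq_gt0 : 0 < 2 * sigma ^+ 2.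
Proof. by rewrite mulr_gt0// exprn_gt0. Qed.

Let quantized_dist i w : `|s i * (rnd (x i w))%:~R - X i w| <= s i * radius.
Proof.
have -> : s i * (rnd (x i w))%:~R - X i w =
    s i * (rounding_error rnd (x i w) + feedback i w).
  by rewrite /rounding_error [Y in _ = s i * (_ - Y + _)]xE -/(feedback i w);
    field; rewrite gt_eqF.
rewrite normrM gtr0_norm// ler_pM2l// (le_trans (ler_normD _ _))//.
by rewrite addrC lerD ?normr_feedback// normr_rounding_error.
Qed.

(** From [(|X| + 2 s radius) ^+ 2], and from [(|X| - 2 s radius) ^+ 2] for [lower]: one radius comes
    from the density bounds and one from replacing [s z] by [X]. The cross term is made quadratic by
    [2 |X| <= 1 + X ^+ 2], so that only the second moment is needed. *)
Let upper i w : R := logterm i +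
  ((1 + 2 * s i * radius) * X i w ^+ 2 + 2 * s i * radius
   + 4 * (s i * radius) ^+ 2) / (2 * sigma ^+ 2).

Let lower i w : R := logterm i +
  ((1 - 2 * s i * radius) * X i w ^+ 2 - 2 * s i * radius) / (2 * sigma ^+ 2).

Let prob a : R := fine (P (Z @^-1` [set a])).

Let radius_ge0 : 0 <= radius.
Proof. by rewrite addr_ge0 ?feedback_bound_ge0. Qed.

Lemma self_information_bounds w :
  \sum_i lower i w <= - ln (prob (Z w)) <= \sum_i upper i w.
Proof.
have := cell_prob (decode (Z w)).
rewrite -ZfiberE -/radius.
have fin : P (Z @^-1` [set Z w]) \is a fin_num.
  by apply: fin_num_measure; exact: measurable_quantizer_fiber.
rewrite -(fineK fin) !lee_fin -/(prob (Z w)).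
have twoE : sigma ^+ 2 *+ 2 = 2 * sigma ^+ 2 by rewrite mulr_natl.
rewrite /pdf_lb /pdf_ub.
under eq_bigr do rewrite mulNr.
under [X in _ && (_ <= X)]eq_bigr do rewrite mulNr.
rewrite !prod_pdfE => /andP[lo up].
have p0 : 0 < prob (Z w) by apply: lt_le_trans lo; exact: expR_gt0.
have sq i : X i w ^+ 2 = `|X i w| ^+ 2 by rewrite real_normK ?num_real.
have sr0 i : 0 <= s i * radius by exact: mulr_ge0 (ltW (s_gt0 i)) radius_ge0.
have hX i : 0 <= s i * radius * (`|X i w| - 1) ^+ 2.
  by rewrite mulr_ge0 ?sqr_ge0.
have zX i : `|s i * (decode (Z w) i)%:~R| = s i * `|(decode (Z w) i)%:~R|.
  by rewrite normrM gtr0_norm.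
apply/andP; split.
  apply: (@le_trans _ _ (\sum_i (logterm i +
      Num.max 0 (s i * (`|(decode (Z w) i)%:~R| - radius)) ^+ 2 / (sigma ^+ 2 *+ 2)))).
    apply: ler_sum => i _; rewrite lerD2l twoE ler_pM2r ?invr_gt0//.
    have zd : `|X i w| - 2 * s i * radius <= s i * (`|(decode (Z w) i)%:~R| - radius).
      rewrite mulrBr -zX; have := quantized_dist i w; rewrite -ZE.
      have := ler_normB (s i * (decode (Z w) i)%:~R) (s i * (decode (Z w) i)%:~R - X i w).
      rewrite opprB addrC subrK; lra.
    rewrite sq; have := hX i; have := sr0 i.
    set A := `|X i w| in zd *; set B := s i * (_ - radius) in zd *.
    have sA : 0 <= s i * radius * A ^+ 2 by rewrite mulr_ge0 ?sqr_ge0.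
    (* If the truncation at 0 is active, then [|X i w| <= 2 * s i * radius], and the quadratic
       expression in [lower] is nonpositive. *)
    have [B0|B0] := leP B 0.
      rewrite expr0n/= => r0 _.
      have A0 : 0 <= A by exact: normr_ge0.
      have : 0 <= A * (2 * s i * radius - A) by rewrite mulr_ge0//; lra.
      have : 0 <= s i * radius * (A - 1) ^+ 2 by rewrite mulr_ge0 ?sqr_ge0.
      by move: sA; rewrite !expr2; lra.
    move=> r0 rA; have [AB|AB] := leP 0 (A - 2 * s i * radius).
      have : (A - 2 * s i * radius) ^+ 2 <= B ^+ 2.
        by rewrite ler_pXn2r ?nnegrE ?(ltW B0).
      have : 0 <= (s i * radius) ^+ 2 by exact: sqr_ge0.
      by move: sA rA; rewrite !expr2; lra.
    have A0 : 0 <= A by exact: normr_ge0.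
    have : 0 <= A * (2 * s i * radius - A) by rewrite mulr_ge0//; lra.
    have : 0 <= B ^+ 2 by exact: sqr_ge0.
    by move: sA rA; rewrite !expr2; lra.
  by rewrite lerNr -ler_expR lnK ?posrE.
apply: (@le_trans _ _ (\sum_i (logterm i +
      (s i * (`|(decode (Z w) i)%:~R| + radius)) ^+ 2 / (sigma ^+ 2 *+ 2)))).
  by rewrite lerNl -ler_expR lnK ?posrE.
apply: ler_sum => i _; rewrite lerD2l twoE ler_pM2r ?invr_gt0//.
have zd : s i * (`|(decode (Z w) i)%:~R| + radius) <= `|X i w| + 2 * s i * radius.
  rewrite mulrDr -zX; have := quantized_dist i w; rewrite -ZE.
  have := ler_normD (s i * (decode (Z w) i)%:~R - X i w) (X i w).
  rewrite subrK; lra.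
have zd0 : 0 <= s i * (`|(decode (Z w) i)%:~R| + radius).
  exact: mulr_ge0 (ltW (s_gt0 i)) (addr_ge0 (normr_ge0 _) radius_ge0).
apply: (@le_trans _ _ ((`|X i w| + 2 * s i * radius) ^+ 2)).
  by rewrite ler_pXn2r ?nnegrE// (le_trans zd0).
by rewrite sq; have := hX i; rewrite !expr2; lra.
Qed.

Lemma integral_rv_sqr i : (\int[P]_w (X i w ^+ 2)%:E = (sigma ^+ 2)%:E)%E.
Proof.
have mf : measurable_fun setT (fun y : R => (y ^+ 2)%:E).
  by apply/measurable_EFinP; exact: exprn_measurable.
have f0 (y : R) : (0 <= (y ^+ 2)%:E)%E by rewrite lee_fin sqr_ge0.
rewrite -(normal_second_moment sigma_gt0) -(integral_normal_law i mf f0).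
by rewrite ge0_integral_distribution.
Qed.

Lemma integrable_rv_sqr i : P.-integrable setT (EFin \o (fun w => X i w ^+ 2)).
Proof.
apply/integrableP; split.
  by apply/measurable_EFinP; exact: measurable_funX.
under eq_integral do rewrite /= ger0_norm ?sqr_ge0//.
by rewrite integral_rv_sqr ltry.
Qed.

Let integrable_affine_sqr i (k a b : R) :
  P.-integrable setT (EFin \o (fun w => k + (a * X i w ^+ 2 + b) / (2 * sigma ^+ 2))).
Proof.
rewrite (_ : _ \o _ = EFin \o (fun w =>
    (k + b / (2 * sigma ^+ 2)) + a / (2 * sigma ^+ 2) * X i w ^+ 2)).
  have c1 := finite_measure_integrable_cst P (k + b / (2 * sigma ^+ 2)) measurableT.
  have c2 := integrableZl measurableT (a / (2 * sigma ^+ 2)) (integrable_rv_sqr i).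
  exact: (integrableD measurableT c1 c2).
by apply/funext => w /=; congr EFin; field; rewrite gt_eqF.
Qed.

Let Rintegral_affine_sqr i (k a b : R) :
  \int[P]_w (k + (a * X i w ^+ 2 + b) / (2 * sigma ^+ 2)) =
  k + (a * sigma ^+ 2 + b) / (2 * sigma ^+ 2).
Proof.
rewrite (_ : (fun w => _) = (fun w =>
    cst (k + b / (2 * sigma ^+ 2)) w + a / (2 * sigma ^+ 2) * X i w ^+ 2)); last first.
  by apply/funext => w /=; field; rewrite gt_eqF.
rewrite RintegralD//; last 2 first.
- exact: (finite_measure_integrable_cst P (k + b / (2 * sigma ^+ 2)) measurableT).
- exact: (integrableZl measurableT (a / (2 * sigma ^+ 2)) (integrable_rv_sqr i)).
rewrite RintegralZl//; last exact: integrable_rv_sqr.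
rewrite Rintegral_prob_cst /Rintegral integral_rv_sqr /=.
by field; rewrite gt_eqF.
Qed.

(** The pointwise bounds are integrated; 1/2 is the mean of [X ^+ 2 / (2 sigma ^+ 2)], and [ln 2]
    converts bits to nats. The error term is that of [upper], which dominates that of [lower]. *)
Lemma entropy_bounds : exists2 h : R, entropy P Z = h%:E &
  `|ln 2 * h - \sum_i (2^-1 - ln (s i * normal_peak sigma))| <=
  \sum_i (s i * radius * (1 + sigma ^+ 2) + 2 * (s i * radius) ^+ 2) / sigma ^+ 2.
Proof.
have mZ := measurable_quantizer_fiber.
have ln20 : 0 < ln 2 :> R by rewrite ln_gt0// ltr1n.
have mln : measurable_fun setT (fun w => - ln (prob (Z w))).
  exact: (@measurable_countable_comp _ _ R _ Z mZ (fun a => - ln (prob a))).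
have up_int i : P.-integrable setT (EFin \o upper i).
  rewrite (_ : upper i = fun w => logterm i + ((1 + 2 * s i * radius) * X i w ^+ 2
     + (2 * s i * radius + 4 * (s i * radius) ^+ 2)) / (2 * sigma ^+ 2)).
    exact: integrable_affine_sqr.
  by apply/funext => w; rewrite /upper; congr (_ + _ / _); rewrite addrA.
have lo_int i : P.-integrable setT (EFin \o lower i) by exact: integrable_affine_sqr.
(* Finiteness of the entropy: a nonnegative self-information lies below the integrable sum of the
   [upper i]. *)
have ln_int : P.-integrable setT (EFin \o (fun w => - ln (prob (Z w)))).
  apply: (le_integrable measurableT) (integrable_fin_sum up_int).
    exact/measurable_EFinP.
  move=> w _; have /andP[_ up] := self_information_bounds w.
  have l0 : 0 <= - ln (prob (Z w)).
    rewrite oppr_ge0 ln_le0// -lee_fin /prob fineK ?probability_le1//.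
    exact: fin_num_measure.
  by rewrite /= lee_fin !ger0_norm// (le_trans l0).
pose H := \int[P]_w (- ln (prob (Z w))).
have upE i : \int[P]_w upper i w = 2^-1 - ln (s i * normal_peak sigma) +
    (s i * radius * (1 + sigma ^+ 2) + 2 * (s i * radius) ^+ 2) / sigma ^+ 2.
  transitivity (\int[P]_w (logterm i + ((1 + 2 * s i * radius) * X i w ^+ 2
     + (2 * s i * radius + 4 * (s i * radius) ^+ 2)) / (2 * sigma ^+ 2))).
    by apply: eq_Rintegral => w _; rewrite /upper addrA.
  by rewrite Rintegral_affine_sqr /logterm; field; rewrite gt_eqF.
have loE i : \int[P]_w lower i w = 2^-1 - ln (s i * normal_peak sigma) -
    s i * radius * (1 + sigma ^+ 2) / sigma ^+ 2.
  by rewrite Rintegral_affine_sqr /logterm; field; rewrite gt_eqF.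
have Hup : H <= \sum_i \int[P]_w upper i w.
  rewrite -Rintegral_fin_sum//; apply: le_Rintegral => //.
    exact: integrable_fin_sum.
  by move=> w _; have /andP[] := self_information_bounds w.
have Hlo : \sum_i \int[P]_w lower i w <= H.
  rewrite -Rintegral_fin_sum//; apply: le_Rintegral => //.
    exact: integrable_fin_sum.
  by move=> w _; have /andP[] := self_information_bounds w.
exists (H / ln 2).
  rewrite entropy_integral// /log2.
  rewrite (_ : (fun w => _) = (fun w => (ln 2)^-1%:E * (- ln (prob (Z w)))%:E)%E).
    rewrite integralZl// /H mulrC EFinM /Rintegral fineK//.
    exact: integrable_fin_num ln_int.
  by apply/funext => w; rewrite -EFinM -mulNr mulrC.
rewrite mulrC divfK ?gt_eqF//.
rewrite (eq_bigr _ (fun i _ => upE i)) big_split/= in Hup.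
rewrite (eq_bigr _ (fun i _ => loE i)) sumrB in Hlo.
have : \sum_i s i * radius * (1 + sigma ^+ 2) / sigma ^+ 2 <=
    \sum_i (s i * radius * (1 + sigma ^+ 2) + 2 * (s i * radius) ^+ 2) / sigma ^+ 2.
  apply: ler_sum => i _; rewrite ler_pM2r ?invr_gt0 ?exprn_gt0// lerDl.
  by rewrite mulr_ge0 ?sqr_ge0.
set A := \sum_i (2^-1 - _) in Hup Hlo *.
by rewrite ler_norml => ?; apply/andP; split; lra.
Qed.

End FeedbackQuantizer.

(** * Small scales *)

Section Scales.
Context {R : realType} {m n : nat}.
Variables (A : 'M[R]_n) (B : 'M[R]_m).
Hypotheses (Apos : posdefmx A) (Bpos : posdefmx B).
Hypotheses (m_gt0 : (0 < m)%N) (n_gt0 : (0 < n)%N).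
Local Notation LA := (revCholesky A).
Local Notation LB := (revCholesky B).

Definition det_scale : R :=
  \det A `^ (2 * n%:R)^-1 * \det B `^ (2 * m%:R)^-1.

(** The step size at gamma = 1. *)
Definition unit_scale (ij : 'I_m * 'I_n) : R :=
  det_scale / (LA ij.2 ij.2 * LB ij.1 ij.1).

Lemma det_scale_gt0 : 0 < det_scale.
Proof. by rewrite mulr_gt0// powR_gt0// posdef_det_gt0. Qed.

Lemma unit_scale_gt0 ij : 0 < unit_scale ij.
Proof.
have [_ LA0 _] := revCholeskyP Apos; have [_ LB0 _] := revCholeskyP Bpos.
exact: divr_gt0 det_scale_gt0 (mulr_gt0 (LA0 _) (LB0 _)).
Qed.

Lemma gptq_scaleE (gamma : R) ij : 0 < gamma ->
  gptq_step_size (gptq_scale gamma A) (gptq_scale gamma B) ij =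
  gamma * unit_scale ij.
Proof.
move=> g0; rewrite /gptq_step_size /gptq_scale /unit_scale /det_scale.
have sg : Num.sqrt gamma * Num.sqrt gamma = gamma.
  by rewrite -expr2 sqr_sqrtr// ltW.
by move: sg; move: (Num.sqrt gamma) => k <-; rewrite (invfM (LA _ _)); ring.
Qed.

Lemma det_scale_sqr :
  det_scale ^+ 2 = \det A `^ n%:R^-1 * \det B `^ m%:R^-1.
Proof.
have sq (k : nat) (a : R) : 0 < a -> (a `^ (2 * k%:R)^-1) ^+ 2 = a `^ k%:R^-1.
  move=> a0; rewrite -powR_mulrn ?powR_ge0// -powRrM invfM.
  by rewrite -mulrA [k%:R^-1 * _]mulrC mulrA mulVf ?mul1r// pnatr_eq0.
by rewrite exprMn !sq// posdef_det_gt0.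
Qed.

Lemma sum_ln_diag k (M : 'M[R]_k) : posdefmx M ->
  \sum_i ln (revCholesky M i i) = ln (\det M) / 2.
Proof.
move=> Mpos; have [_ L0 _] := revCholeskyP Mpos.
have ln_prod : ln (\prod_i revCholesky M i i) = \sum_i ln (revCholesky M i i).
  rewrite -[RHS](@expRK R) expR_sum; congr ln; apply: eq_bigr => i _.
  by rewrite lnK// posrE.
by rewrite det_revCholesky// lnXn ?prodr_gt0// ln_prod; field.
Qed.

(** The reason for the determinant powers in the scales: over all entries they contribute
    [m/2 ln |A| + n/2 ln |B|], exactly the sum of the logarithms of the diagonal entries. *)
Lemma sum_ln_unit_scale : \sum_ij ln (unit_scale ij) = 0.
Proof.
have [_ LA0 _] := revCholeskyP Apos; have [_ LB0 _] := revCholeskyP Bpos.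
have lnE ij : ln (unit_scale ij) =
    ln det_scale - ln (LA ij.2 ij.2) - ln (LB ij.1 ij.1).
  rewrite /unit_scale ln_div ?posrE; [|exact: det_scale_gt0|exact: mulr_gt0].
  by rewrite [ln (LA _ _ * _)]lnM ?posrE// opprD addrA.
rewrite (eq_bigr _ (fun ij _ => lnE ij)).
rewrite -(pair_bigA _ (fun i j => ln det_scale - ln (LA j j) - ln (LB i i)))/=.
under eq_bigr => i _.
  rewrite !sumrB !sumr_const !card_ord sum_ln_diag//.
  over.
rewrite !sumrB !sumr_const !card_ord sumrMnl sum_ln_diag//.
rewrite /det_scale lnM ?posrE ?powR_gt0 ?posdef_det_gt0// !ln_powR.
field.
by rewrite !pnatr_eq0 -!lt0n m_gt0 n_gt0.
Qed.

End Scales.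

Section Distortion.
Context {R : realType} {m n : nat}.
Variables (A : 'M[R]_n) (B : 'M[R]_m) (H Hhalf : 'M[R]_(n * m)).
Hypotheses (Apos : posdefmx A) (Bpos : posdefmx B) (Hpos : posdefmx H).
Hypothesis HhalfE : Hhalf *m Hhalf^T = H.
Local Notation LA := (revCholesky A).
Local Notation LB := (revCholesky B).

Let G := invmx LA *t invmx LB.

(** The form of [H] pulled back to the vector of rounding errors, since [vec (V - W)] is a multiple
    of [G] times that vector. *)
Definition error_form : 'M[R]_(n * m) := G^T *m H *m G.

(** By cyclicity of the trace only [G *m G^T] matters, and this is the inverse of [A *t B]. *)
Lemma tr_error_form : \tr error_form = \tr (H *m invmx (A *t B)).
Proof.
have uA : A \in unitmx by rewrite unitmxE unitfE gt_eqF// posdef_det_gt0.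
have uB : B \in unitmx by rewrite unitmxE unitfE gt_eqF// posdef_det_gt0.
rewrite /error_form mxtrace_mulC mulmxA mxtrace_mulC invmx_tens//.
by rewrite (invmx_revCholesky Apos) (invmx_revCholesky Bpos) -tensmx_mul -trmx_tens.
Qed.

Lemma tr_error_form_gt0 : (0 < n * m)%N -> 0 < \tr error_form.
Proof.
have [LA_trig LA0 _] := revCholeskyP Apos.
have [LB_trig LB0 _] := revCholeskyP Bpos.
move=> nm; apply: posdef_tr_gt0 => //; apply: posdef_congr => //.
have uA := trig_unitmx LA_trig LA0; have uB := trig_unitmx LB_trig LB0.
have : G *m (LA *t LB) = 1%:M by rewrite tensmx_mul !mulVmx// tens1mx1.
by move=> /mulmx1_unit[].
Qed.

Definition entry_index (p : 'I_(n * m)) : 'I_m * 'I_n :=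
  ((mxtens_unindex p).2, (mxtens_unindex p).1).

Lemma entry_index_inj : injective entry_index.
Proof.
move=> p q; rewrite /entry_index => e.
apply: (can_inj (@mxtens_unindexK n m)); move: e.
by case: (mxtens_unindex p) => a b; case: (mxtens_unindex q) => a' b' [-> ->].
Qed.

Lemma frobenius_norm_rowE (v : 'cV[R]_(n * m)) :
  frobenius_norm (v^T *m Hhalf) ^+ 2 = (v^T *m H *m v) 0 0.
Proof.
rewrite sqr_sqrtr; last by apply: sumr_ge0 => i _; apply: sumr_ge0 => j _; exact: sqr_ge0.
rewrite big_ord1 -HhalfE.
have -> : v^T *m (Hhalf *m Hhalf^T) *m v = (v^T *m Hhalf) *m (v^T *m Hhalf)^T.
  by rewrite trmx_mul trmxK !mulmxA.
rewrite [RHS]mxE; apply: eq_bigr => j _; rewrite [X in _ = _ * X]mxE.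
by rewrite expr2.
Qed.

(** The division by [L j j] in the scales cancels the normalization of the columns of the inverse
    factors, so all rounding errors enter with the common factor [gamma * det_scale A B]. *)
Lemma gptq_squared_error (rnd : R -> int) (gamma : R) (W : 'M[R]_(m, n)) :
  0 < gamma ->
  let alpha := gptq_scale gamma A in let beta := gptq_scale gamma B in
  let u ij := rounding_error rnd (gptq_input rnd A B alpha beta W ij) in
  frobenius_norm (((vec (dequantize alpha beta (gptq rnd A B alpha beta W)))^T
     - (vec W)^T) *m Hhalf) ^+ 2 =
  (gamma * det_scale A B) ^+ 2 *
    \sum_p \sum_q error_form p q * (u (entry_index p) * u (entry_index q)).
Proof.
move=> g0 alpha beta u; set V := dequantize _ _ _.
have [LA_trig LA0 _] := revCholeskyP Apos.
have [LB_trig LB0 _] := revCholeskyP Bpos.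
have step_neq0 ij : gptq_step_size alpha beta ij != 0.
  by rewrite gptq_scaleE// mulf_neq0 ?gt_eqF ?unit_scale_gt0.
pose U := \matrix_(i, j) u (i, j).
have VW : V - W = (gamma * det_scale A B) *: (invmx LB *m U *m (invmx LA)^T).
  rewrite gptq_errorE//; apply/matrixP => i j; rewrite !mxE mulr_sumr.
  apply: eq_bigr => l _; rewrite !mxE [in RHS]mulr_suml mulr_suml mulr_sumr.
  apply: eq_bigr => k _; rewrite !mxE gptq_scaleE// -/alpha -/beta -/(u (k, l)).
  rewrite /unit_scale !invmx_trig_diag//=; field.
  by rewrite !gt_eqF.
have vB : (vec V)^T - (vec W)^T = (vec (V - W))^T.
  by apply/matrixP => i j; rewrite !mxE.
have vZ : vec (V - W) = (gamma * det_scale A B) *: (G *m vec U).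
  by rewrite VW -vec_mulmx; apply/matrixP => i j; rewrite !mxE.
rewrite vB frobenius_norm_rowE vZ.
set c := gamma * _; rewrite [(c *: _)^T]linearZ/= -!scalemxAl -scalemxAr scalerA.
rewrite mxE -expr2; congr (_ * _).
have -> : (G *m vec U)^T *m H *m (G *m vec U) =
    (vec U)^T *m error_form *m vec U.
  by rewrite trmx_mul /error_form !mulmxA.
rewrite mxE exchange_big; apply: eq_bigr => q _; rewrite mxE mulr_suml.
by apply: eq_bigr => p _; rewrite !mxE /entry_index; ring.
Qed.

End Distortion.

Section SmallScale.
Context {d : measure_display} {T : measurableType d} {R : realType}.
Variables (P : probability T R) (sigma : R) (m n : nat).
Variable X : 'I_m -> 'I_n -> {RV P >-> R}.
Variables (A : 'M[R]_n) (B : 'M[R]_m) (H Hhalf : 'M[R]_(n * m)) (rnd : R -> int).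
Hypotheses (sigma_gt0 : 0 < sigma) (X_iid : iid_normal sigma X).
Hypotheses (m_gt0 : (0 < m)%N) (n_gt0 : (0 < n)%N).
Hypotheses (Apos : posdefmx A) (Bpos : posdefmx B) (Hpos : posdefmx H).
Hypotheses (HhalfE : Hhalf *m Hhalf^T = H) (rnd_nearest : nearest_integer rnd).

Local Notation alpha gamma := (gptq_scale gamma A).
Local Notation beta gamma := (gptq_scale gamma B).
Local Notation tau := (unit_scale A B).

Let rv (ij : 'I_m * 'I_n) : {RV P >-> R} := X ij.1 ij.2.

Let rv_law ij (E : set R) : measurable E ->
  distribution P (rv ij) E = normal_prob 0 sigma E.
Proof. exact: X_iid.1. Qed.

Let rv_indep : mutually_independent P (fun ij => rv ij : T -> R) := X_iid.2.

Let input (gamma : R) ij w :=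
  gptq_input rnd A B (alpha gamma) (beta gamma) (random_matrix X w) ij.

(** The feedback coefficients involve only ratios of scales, so gamma has cancelled and the feedback
    stays bounded as gamma tends to 0. *)
Let gain (ij kl : 'I_m * 'I_n) : R :=
  tau kl / tau ij * gptq_direction A B kl ij.1 ij.2.

Let tau_gt0 ij : 0 < tau ij := unit_scale_gt0 Apos Bpos ij.

Let inputE gamma : 0 < gamma -> forall ij w, input gamma ij w =
  rv ij w / (gamma * tau ij) +
  \sum_(kl | (gptq_rank kl < gptq_rank ij)%N)
     gain ij kl * rounding_error rnd (input gamma kl w).
Proof.
move=> g0 ij w.
have s0 kl : gptq_step_size (alpha gamma) (beta gamma) kl != 0.
  by rewrite gptq_scaleE// mulf_neq0// gt_eqF.
rewrite /input gptq_inputE// mxE gptq_scaleE//; congr (_ + _).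
apply: eq_bigr => kl _; rewrite gptq_scaleE// /gain; congr (_ * _ * _).
by field; rewrite !gt_eqF.
Qed.

Let step_gt0 gamma : 0 < gamma -> forall ij, 0 < gamma * tau ij.
Proof. by move=> g0 ij; rewrite mulr_gt0. Qed.

(** If the errors had covariance exactly 1/12 times the identity, the mean of the quadratic form
    would be its trace over 12; the deviation is at most the sum of the absolute entries of [Q]
    times the correlation bound. *)
Lemma distortion_small_scale : exists K : R, forall gamma : R,
  0 < gamma -> gamma <= 1 -> gamma * K <= 1 ->
  exists2 delta : R,
    distortion P Hhalf (random_matrix X)
      (fun w => dequantize (alpha gamma) (beta gamma)
         (gptq rnd A B (alpha gamma) (beta gamma) (random_matrix X w))) =
    (gamma ^+ 2 / 12 *
     (\det A `^ n%:R^-1 * \det B `^ m%:R^-1 *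
      (\tr (H *m invmx (A *t B)) / (m * n)%:R)) * (1 + delta))%:E &
    `|delta| <= K * gamma.
Proof.
have nm_gt0 : (0 < n * m)%N by rewrite muln_gt0 n_gt0.
pose Q := error_form A B H.
have trQ : 0 < \tr Q := tr_error_form_gt0 Apos Bpos Hpos nm_gt0.
pose t : R := \sum_ij tau ij.
have t0 : 0 <= t by apply: sumr_ge0 => ij _; exact: ltW.
have tau_le ij : tau ij <= t.
  by rewrite /t (bigD1 ij)//= lerDl sumr_ge0// => kl _; exact: ltW.
(* For [gamma <= 1] the quadratic term of [rounding_defect] is at most [gamma * t ^+ 2], so
   [gamma * K1] bounds all defects. *)
pose K1 := (t ^+ 2 + t * (1 + sigma ^+ 2)) / (2 * sigma ^+ 2).
pose normQ := \sum_p \sum_q `|Q p q|.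
pose K2 := 12 / \tr Q * (K1 * normQ).
have sig1 : 0 <= 1 + sigma ^+ 2 by rewrite addr_ge0 ?sqr_ge0.
have K1_ge0 : 0 <= K1.
  apply: divr_ge0; last by rewrite mulr_ge0 ?sqr_ge0.
  by apply: addr_ge0; [exact: sqr_ge0|exact: mulr_ge0].
have normQ_ge0 : 0 <= normQ by apply: sumr_ge0 => p _; exact: sumr_ge0.
have K2_ge0 : 0 <= K2 by rewrite mulr_ge0 ?(mulr_ge0 K1_ge0)// divr_ge0// ltW.
(* [K1] ensures that the common defect [gamma * K1] is at most 1; [K2] bounds the relative error of
   the distortion. *)
exists (K1 + K2) => gamma g0 g1 gK.
have e1 : gamma * K1 <= 1.
  by apply: le_trans gK; rewrite ler_wpM2l ?(ltW g0)// lerDl.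
have defect ij : rounding_defect sigma (gamma * tau ij) <= gamma * K1.
  rewrite /rounding_defect /K1 mulrA ler_pM2r ?invr_gt0 ?mulr_gt0 ?exprn_gt0//.
  rewrite [leRHS]mulrDr lerD//.
    rewrite exprMn ler_pM ?sqr_ge0//; last first.
      by rewrite ler_pXn2r ?nnegrE ?(ltW (tau_gt0 _)).
    by rewrite expr2 ler_piMl// ltW.
  by rewrite mulrA ler_wpM2r// ler_wpM2l// ltW.
pose u p w := rounding_error rnd (input gamma (entry_index p) w).
pose rho p q := \int[P]_w (u p w * u q w).
have rhoE p q : `|rho p q - (p == q)%:R / 12| <= gamma * K1.
  have := expectation_error_product sigma_gt0 rv_law rv_indep rnd_nearest
    gptq_rank_inj (step_gt0 g0) (inputE g0) e1 defect (entry_index p) (entry_index q).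
  by rewrite (inj_eq (@entry_index_inj m n)).
have uu_int p q : P.-integrable setT (EFin \o (fun w => u p w * u q w)).
  apply: (@bounded_integrable _ _ _ _ _ (2^-1 * 2^-1)).
    apply: measurable_funM;
      exact: (measurable_input_error rnd_nearest (inputE g0)).
  by move=> w; rewrite normrM ler_pM//; exact: normr_rounding_error.
have Quu_int p q : P.-integrable setT (EFin \o (fun w => Q p q * (u p w * u q w))).
  exact: (integrableZl measurableT (Q p q) (uu_int p q)).
have Qp_int p : P.-integrable setT
    (EFin \o (fun w => \sum_q Q p q * (u p w * u q w))).
  exact: integrable_fin_sum.
have Q_int : P.-integrable setT
    (EFin \o (fun w => \sum_p \sum_q Q p q * (u p w * u q w))).
  exact: integrable_fin_sum.
pose S := \sum_p \sum_q Q p q * rho p q.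
have SE : \int[P]_w (\sum_p \sum_q Q p q * (u p w * u q w)) = S.
  rewrite Rintegral_fin_sum//; apply: eq_bigr => p _.
  rewrite Rintegral_fin_sum//; apply: eq_bigr => q _.
  by rewrite RintegralZl.
pose k := (gamma * det_scale A B) ^+ 2.
exists (12 / \tr Q * S - 1).
  rewrite /distortion unlock.
  rewrite (_ : (\int[P]_w _)%E = (k * S)%:E); last first.
    rewrite -SE EFinM /Rintegral fineK; last exact: integrable_fin_num Q_int.
    rewrite -integralZl//; apply: eq_integral => w _.
    by rewrite (gptq_squared_error Apos Bpos HhalfE).
  rewrite -EFinM; congr EFin; rewrite -(tr_error_form H Apos Bpos) -/Q.
  rewrite -(det_scale_sqr Apos Bpos) /k.
  by field; rewrite !pnatr_eq0 -!lt0n m_gt0 n_gt0 gt_eqF.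
have -> : 12 / \tr Q * S - 1 = 12 / \tr Q * (S - \tr Q / 12).
  by field; rewrite gt_eqF.
rewrite normrM gtr0_norm ?divr_gt0//.
apply: (@le_trans _ _ (12 / \tr Q * (gamma * K1 * normQ))); last first.
  rewrite (_ : 12 / \tr Q * (gamma * K1 * normQ) = K2 * gamma).
    by rewrite ler_wpM2r ?(ltW g0)// lerDr.
  by rewrite /K2; ring.
rewrite ler_wpM2l ?divr_ge0 ?(ltW trQ)//.
have -> : S - \tr Q / 12 = \sum_p \sum_q Q p q * (rho p q - (p == q)%:R / 12).
  rewrite /S /mxtrace mulr_suml -sumrB; apply: eq_bigr => p _.
  under [RHS]eq_bigr do rewrite mulrBr.
  rewrite sumrB; congr (_ - _); rewrite (bigD1 p)//= big1 ?addr0 ?eqxx ?mul1r//.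
  by move=> q; rewrite eq_sym => /negbTE ->; rewrite mul0r mulr0.
rewrite /normQ mulr_sumr (le_trans (ler_norm_sum _ _ _))//.
apply: ler_sum => p _; rewrite mulr_sumr (le_trans (ler_norm_sum _ _ _))//.
by apply: ler_sum => q _; rewrite normrM mulrC ler_wpM2r.
Qed.

(** In [entropy_bounds] the scales enter the main term only through the sum of their logarithms,
    which is [m n ln gamma]; for [gamma <= 1] the quadratic part of the error is absorbed by a
    linear one. *)
Lemma entropy_small_scale : exists K : R, forall gamma : R,
  0 < gamma -> gamma <= 1 ->
  exists2 h : R,
    entropy P (fun w => gptq rnd A B (alpha gamma) (beta gamma) (random_matrix X w)) =
    h%:E &
    `|h / (m * n)%:R - (2^-1 * log2 (2 * pi * expR 1 * sigma ^+ 2) - log2 gamma)|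
      <= K * gamma.
Proof.
pose r : R := feedback_bound gain + 2^-1.
have r0 : 0 <= r by rewrite addr_ge0 ?feedback_bound_ge0.
pose K0 := \sum_ij (tau ij * r * (1 + sigma ^+ 2) + 2 * (tau ij * r) ^+ 2) / sigma ^+ 2.
have N0 : 0 < (m * n)%:R :> R by rewrite ltr0n muln_gt0 m_gt0.
have ln20 : 0 < ln 2 :> R by rewrite ln_gt0// ltr1n.
exists (K0 / ((m * n)%:R * ln 2)) => gamma g0 g1.
pose decode (z : 'M[int]_(m, n)) (ij : 'I_m * 'I_n) := z ij.1 ij.2.
have decode_inj (a b : 'M[int]_(m, n)) : decode a =1 decode b -> a = b.
  by move=> ab; apply/matrixP => i j; exact: (ab (i, j)).
have s0 kl : gptq_step_size (alpha gamma) (beta gamma) kl != 0.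
  by rewrite gptq_scaleE// mulf_neq0// gt_eqF.
have ZE w ij : decode (gptq rnd A B (alpha gamma) (beta gamma) (random_matrix X w)) ij
    = rnd (input gamma ij w).
  by case: ij => i j; rewrite /decode gptqE.
have [h hE hB] := entropy_bounds sigma_gt0 rv_law rv_indep rnd_nearest
    gptq_rank_inj (step_gt0 g0) (inputE g0) decode_inj ZE.
exists h => //.
have peak0 : 0 < normal_peak sigma by rewrite normal_peak_gt0// gt_eqF.
have sumE : \sum_ij (2^-1 - ln (gamma * tau ij * normal_peak sigma)) =
    (m * n)%:R * (2^-1 - ln gamma - ln (normal_peak sigma)).
  have lE ij : 2^-1 - ln (gamma * tau ij * normal_peak sigma) =
      (2^-1 - ln gamma - ln (normal_peak sigma)) - ln (tau ij).
    have lnM' (a b : R) : 0 < a -> 0 < b -> ln (a * b) = ln a + ln b.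
      by move=> a0 b0; rewrite lnM ?posrE.
    by rewrite (lnM' _ _ (step_gt0 g0 ij) peak0) (lnM' _ _ g0 (tau_gt0 ij)); lra.
  rewrite (eq_bigr _ (fun ij _ => lE ij)) sumrB sum_ln_unit_scale// subr0.
  by rewrite sumr_const card_prod !card_ord mulr_natl.
(* The inverse square of [normal_peak sigma] is [2 pi sigma ^+ 2], and the factor [expR 1] accounts
   for the term 1/2. *)
have rateE : 2^-1 * log2 (2 * pi * expR 1 * sigma ^+ 2) - log2 gamma =
    (2^-1 - ln gamma - ln (normal_peak sigma)) / ln 2.
  have -> : 2 * pi * expR 1 * sigma ^+ 2 = (normal_peak sigma)^-1 ^+ 2 * expR 1.
    rewrite normal_peakE// invrK exprMn sqr_sqrtr; first by ring.
    by apply: mulrn_wge0; exact: pi_ge0.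
  have ip0 : 0 < (normal_peak sigma)^-1 by rewrite invr_gt0.
  rewrite /log2 lnM ?posrE; [|exact: exprn_gt0|exact: expR_gt0].
  rewrite expRK lnXn// lnV ?posrE//.
  by field; rewrite gt_eqF.
rewrite sumE in hB; rewrite rateE.
have -> : h / (m * n)%:R - (2^-1 - ln gamma - ln (normal_peak sigma)) / ln 2 =
    (ln 2 * h - (m * n)%:R * (2^-1 - ln gamma - ln (normal_peak sigma))) /
    ((m * n)%:R * ln 2).
  by field; rewrite !pnatr_eq0 -!lt0n m_gt0 n_gt0 gt_eqF.
have NL : 0 < (m * n)%:R * ln 2 :> R by exact: mulr_gt0.
rewrite normrM [X in _ * X]gtr0_norm ?invr_gt0// mulrAC ler_pM2r ?invr_gt0//.
apply: (le_trans hB); rewrite /K0 mulr_suml; apply: ler_sum => ij _.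
rewrite [leRHS]mulrAC ler_pM2r ?invr_gt0 ?exprn_gt0//.
rewrite -/r -subr_ge0.
rewrite (_ : _ - _ = 2 * (tau ij * r) ^+ 2 * (gamma * (1 - gamma))); last by ring.
apply: mulr_ge0; first by rewrite mulr_ge0 ?sqr_ge0.
by rewrite mulr_ge0 ?subr_ge0// ltW.
Qed.

End SmallScale.

(** * The iterated limit *)

Section SmallO.
Context {R : realType}.
Implicit Type eps : gptq_data R -> R -> \bar R.

Lemma is_o1P eps : is_o1 eps <-> forall s : nat -> gptq_data R,
  (nrow (s k) * ncol (s k))%N @[k --> \oo] --> \oo ->
  forall e : R, 0 < e -> \forall k \near \oo, \forall g \near 0^'+,
    (`|eps (s k) g| <= e%:E)%E.
Proof.
split=> [oeps s /oeps cv e e0|H s /H {}H].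
  have : \forall k \near \oo,
      (limf_esup (fun g : R => `|eps (s k) g|%E) 0^'+ < e%:E)%E.
    by apply: (cv [set y | (y < e%:E)%E]); apply: open_ereal_lt'; rewrite lte_fin.
  apply: filterS => k; rewrite limf_esupE => /ereal_inf_lt[_ [V V0 <-] Ve].
  apply: filterS V0 => g Vg; apply/ltW/(le_lt_trans _ Ve).
  by apply: ereal_sup_ubound; exists g.
pose L k := limf_esup (fun g : R => `|eps (s k) g|%E) 0^'+.
have L0 k : (0 <= L k)%E.
  by apply: limf_esup_ge0 => //; exact: filter_not_empty.
have Le e : 0 < e -> \forall k \near \oo, (L k <= e%:E)%E.
  move=> e0; apply: filterS (H e e0) => k He; rewrite /L limf_esupE.
  apply: (@le_trans _ _ (ereal_sup
    ((fun g : R => `|eps (s k) g|%E) @` [set g | (`|eps (s k) g| <= e%:E)%E]))).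
    by apply: ereal_inf_lbound; exists [set g | (`|eps (s k) g| <= e%:E)%E].
  by apply: ge_ereal_sup => _ [g ge <-].
apply/fine_cvgP; split.
  apply: filterS (Le 1 ltr01) => k Lk.
  by rewrite ge0_fin_numE ?L0// (le_lt_trans Lk)// ltry.
apply/cvgrPdist_le => e e0; apply: filterS (Le e e0) => k Lk.
rewrite sub0r normrN /= ger0_norm ?fine_ge0// ?L0//.
by rewrite -lee_fin fineK// ge0_fin_numE ?L0// (le_lt_trans Lk)// ltry.
Qed.

Lemma near_linear_le (K e : R) : 0 < e -> \forall g \near (0 : R)^'+, K * g <= e.
Proof.
move=> e0; near=> g.
have g0 : 0 < g by near: g; exact: nbhs_right_gt.
have K1 : 0 < `|K| + 1 by rewrite ltr_wpDl.
apply: (@le_trans _ _ ((`|K| + 1) * g)).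
  by rewrite ler_wpM2r ?(ltW g0)// (le_trans (ler_norm K))// lerDl.
rewrite mulrC -ler_pdivlMr//; near: g; apply: nbhs_right_le.
by rewrite divr_gt0.
Unshelve. all: by end_near. Qed.

(** [eq_mul_1o1] asks for an equality at every gamma, whereas the distortion is shown to be finite
    only for small gamma; hence the infinite cases. *)
Lemma ratio_error (a : \bar R) (y : R) : 0 < y ->
  a = (y%:E * (1 + (a * y^-1%:E - 1)))%E.
Proof.
move=> y0; case: a => [r| |].
- have rE : r = y * (1 + (r * y^-1 - 1)) by field; rewrite gt_eqF.
  exact: (congr1 EFin rE).
- rewrite mulyr gtr0_sg ?invr_gt0// mul1e.
  by rewrite /= mulry gtr0_sg// mul1e.
- rewrite mulNyr gtr0_sg ?invr_gt0// mul1e.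
  by rewrite /= mulrNy gtr0_sg// mul1e.
Qed.

(** Both sides come from the tangent inequality, at [y] and at [- y]; the latter gives
    [expR y * (1 - y) <= 1]. *)
Lemma normr_expR_sub1 (y : R) : `|y| <= 2^-1 -> `|expR y - 1| <= 2 * `|y|.
Proof.
move=> y2; have [l u] : - `|y| <= y /\ y <= `|y|.
  by apply/andP; rewrite -ler_norml.
have ey := expR_ge1Dx y; have eNy := expR_ge1Dx (- y).
have e0 := expR_gt0 y.
have : expR y * (1 - y) <= 1.
  have e1 : expR y * expR (- y) = 1 by rewrite -expRD subrr expR0.
  by rewrite -[leRHS]e1 ler_pM2l.
move: l u y2 (normr_ge0 y); set a := `|y| => l u a2 a0 H.
rewrite ler_norml; apply/andP; split; first by lra.
rewrite lerBlDr -(ler_pM2r (_ : 0 < 1 - y)); last by lra.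
apply: (le_trans H).
have : 0 <= (a - y) by lra.
have : 0 <= a * (2^-1 - y) by rewrite mulr_ge0//; lra.
by rewrite !mulrDl !mulrDr; lra.
Qed.

End SmallO.

Theorem theorem4p1 (R : realType) (sigma : R) (sigma_gt0 : 0 < sigma)
    (d : nat -> nat -> measure_display)
    (T : forall m n, measurableType (d m n))
    (P : forall m n, probability (T m n) R)
    (X : forall m n, 'I_m -> 'I_n -> {RV (P m n) >-> R})
    (X_iid : forall m n, (0 < m)%N -> (0 < n)%N ->
       iid_normal sigma (@X m n))
    (rnd : R -> int) (rnd_nearest : nearest_integer rnd)
    (msqrt : forall N : nat, 'M[R]_N -> 'M[R]_N)
    (msqrtP : forall (N : nat) (M : 'M[R]_N), posdefmx M ->
       msqrt N M *m (msqrt N M)^T = M)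
    (code : forall m n, 'M[R]_n -> 'M[R]_m -> R -> 'M[int]_(m, n) -> seq bool)
    (code_prefix_free : forall (x : gptq_data R) (gamma : R), 0 < gamma ->
       prefix_free (code (nrow x) (ncol x) (matA x) (matB x) gamma)) :
  let W (x : gptq_data R) := random_matrix (@X (nrow x) (ncol x)) in
  let alpha (x : gptq_data R) (gamma : R) := gptq_scale gamma (matA x) in
  let beta (x : gptq_data R) (gamma : R) := gptq_scale gamma (matB x) in
  let Z (x : gptq_data R) (gamma : R) := fun w =>
    gptq rnd (matA x) (matB x) (alpha x gamma) (beta x gamma) (W x w) in
  let V (x : gptq_data R) (gamma : R) := fun w =>
    dequantize (alpha x gamma) (beta x gamma) (Z x gamma w) in
  let c (x : gptq_data R) (gamma : R) :=
    code (nrow x) (ncol x) (matA x) (matB x) gamma in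
  let D (x : gptq_data R) (gamma : R) :=
    distortion (P (nrow x) (ncol x)) (msqrt _ (matH x)) (W x)
      (V x gamma) in
  let Rate (x : gptq_data R) (gamma : R) :=
    rate (P (nrow x) (ncol x)) (c x gamma) (Z x gamma) in
  eq_add_omn
    (fun x gamma =>
       expected_length (P (nrow x) (ncol x)) (c x gamma) (Z x gamma))
    (fun x gamma => entropy (P (nrow x) (ncol x)) (Z x gamma)) ->
  (* For a given (m, n, H, A, B) the hypothesis above does not exclude
     Rate = +oo for large gamma, whence [fine] in the last formula; this has
     no bearing on the limit. *)
  [/\ eq_mul_1o1 D
        (fun x gamma => (gamma ^+ 2 / 12 * hessian_factor x)%:E),
      eq_add_o1 Rate
        (fun x gamma =>
           (2^-1 * log2 (2 * pi * expR 1 * sigma ^+ 2) - log2 gamma)%:E)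
    & eq_mul_1o1 D
        (fun x gamma =>
           (2 * pi * expR 1 / 12 * sigma ^+ 2 * hessian_factor x *
            2 `^ (- 2 * fine (Rate x gamma)))%:E)].
Proof.
move=> W alpha beta Z V c D Rate code_len.
pose r (g : R) : R := 2^-1 * log2 (2 * pi * expR 1 * sigma ^+ 2) - log2 g.
pose Y1 (x : gptq_data R) (g : R) := g ^+ 2 / 12 * hessian_factor x.
have N_gt0 (x : gptq_data R) : 0 < (nrow x * ncol x)%:R :> R.
  by rewrite ltr0n muln_gt0 nrow_gt0 ncol_gt0.
have hess_gt0 (x : gptq_data R) : 0 < hessian_factor x.
  have Ap := matA_posdef x; have Bp := matB_posdef x.
  rewrite /hessian_factor -(det_scale_sqr Ap Bp) -(tr_error_form _ Ap Bp).
  apply: mulr_gt0; first by apply: exprn_gt0; exact: det_scale_gt0.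
  apply: divr_gt0 => //; apply: (tr_error_form_gt0 Ap Bp (matH_posdef x)).
  by rewrite muln_gt0 nrow_gt0 ncol_gt0.
have Y1_gt0 x g : 0 < g -> 0 < Y1 x g.
  by move=> g0; rewrite mulr_gt0// divr_gt0// exprn_gt0.
have dist_near x e : 0 < e -> \forall g \near (0 : R)^'+,
    exists2 delta : R, D x g = (Y1 x g * (1 + delta))%:E & `|delta| <= e.
  move=> e0; have [K KP] := distortion_small_scale sigma_gt0
    (X_iid _ _ (nrow_gt0 x) (ncol_gt0 x)) (nrow_gt0 x) (ncol_gt0 x) (matA_posdef x)
    (matB_posdef x) (matH_posdef x) (msqrtP _ _ (matH_posdef x)) rnd_nearest.
  near=> g.
  have [||| delta DE dK] := KP g.
  - by near: g; exact: nbhs_right_gt.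
  - by near: g; exact: nbhs_right_le.
  - by rewrite mulrC; near: g; exact: near_linear_le.
  exists delta; first exact: DE.
  by apply: (le_trans dK); near: g; exact: near_linear_le.
have ent_near x e : 0 < e -> \forall g \near (0 : R)^'+,
    exists2 h : R, entropy (P (nrow x) (ncol x)) (Z x g) = h%:E &
    `|h / (nrow x * ncol x)%:R - r g| <= e.
  move=> e0; have [K KP] := entropy_small_scale sigma_gt0
    (X_iid _ _ (nrow_gt0 x) (ncol_gt0 x)) (nrow_gt0 x) (ncol_gt0 x) (matA_posdef x)
    (matB_posdef x) rnd_nearest.
  near=> g.
  have [|| h hE hK] := KP g.
  - by near: g; exact: nbhs_right_gt.
  - by near: g; exact: nbhs_right_le.
  exists h; first exact: hE.
  by apply: (le_trans hK); near: g; exact: near_linear_le.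
have [eps eps_o1 epsE] := code_len.
have rate_near s : (nrow (s k) * ncol (s k))%N @[k --> \oo] --> \oo ->
    forall e, 0 < e -> \forall k \near \oo, \forall g \near (0 : R)^'+,
      exists2 delta : R, Rate (s k) g = (r g + delta)%:E & `|delta| <= e.
  move=> soo e e0; have e20 : 0 < e / 2 by rewrite divr_gt0.
  have := (is_o1P eps).1 eps_o1 s soo _ e20; apply: filterS => k epsk.
  near=> g.
  have g0 : 0 < g by near: g; exact: nbhs_right_gt.
  have [h hE hr] : exists2 h : R,
      entropy (P (nrow (s k)) (ncol (s k))) (Z (s k) g) = h%:E &
      `|h / (nrow (s k) * ncol (s k))%:R - r g| <= e / 2.
    by near: g; exact: ent_near.
  have : (`|eps (s k) g| <= (e / 2)%:E)%E by near: g; exact: epsk.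
  rewrite /Rate /rate epsE// hE.
  (* The bound by [e / 2] excludes infinite values of [eps], so the rate is finite here. *)
  case: (eps (s k) g) => [t| |]; rewrite ?leye_eq//= lee_fin => te.
  exists (h / (nrow (s k) * ncol (s k))%:R - r g + t).
    have NE : (nrow (s k) * ncol (s k))%:R^-1 *
        (h + (nrow (s k) * ncol (s k))%:R * t) =
        r g + (h / (nrow (s k) * ncol (s k))%:R - r g + t).
      by have N0 := N_gt0 (s k); field; rewrite !pnatr_eq0 -!lt0n nrow_gt0 ncol_gt0.
    exact: (congr1 EFin NE).
  by rewrite (le_trans (ler_normD _ _))// [leRHS]splitr lerD.
split.
- exists (fun x g => D x g * (Y1 x g)^-1%:E - 1)%E; last first.
    by move=> x g g0; exact: ratio_error (Y1_gt0 x g g0).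
  apply/is_o1P => s soo e e0; near=> k; near=> g.
  have g0 : 0 < g by near: g; exact: nbhs_right_gt.
  have [delta -> de] : exists2 delta : R,
      D (s k) g = (Y1 (s k) g * (1 + delta))%:E & `|delta| <= e.
    by near: g; exact: dist_near.
  have Y0 := Y1_gt0 (s k) g g0.
  have dE : Y1 (s k) g * (1 + delta) * (Y1 (s k) g)^-1 - 1 = delta.
    by field; rewrite gt_eqF.
  rewrite (_ : (_ - 1)%E = delta%:E); last exact: (congr1 EFin dE).
  by rewrite /= lee_fin.
- exists (fun x g => Rate x g - (r g)%:E)%E; last first.
    by move=> x g g0; rewrite addeC subeK.
  apply/is_o1P => s soo e e0.
  apply: filterS (rate_near s soo e e0) => k; apply: filterS => g.
  move=> [delta -> de]; rewrite -EFinB /= lee_fin.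
  by rewrite (_ : r g + delta - r g = delta)//; ring.
pose Y3 x g := 2 * pi * expR 1 / 12 * sigma ^+ 2 * hessian_factor x *
  2 `^ (- 2 * fine (Rate x g)).
have pes0 : 0 < 2 * pi * expR 1 * sigma ^+ 2 :> R.
  by rewrite mulr_gt0 ?exprn_gt0// mulr_gt0 ?expR_gt0// mulr_gt0// pi_gt0.
have Y3_gt0 x g : 0 < Y3 x g.
  rewrite mulr_gt0 ?powR_gt0// mulr_gt0// mulrAC divr_gt0//.
exists (fun x g => D x g * (Y3 x g)^-1%:E - 1)%E; last first.
  by move=> x g g0; exact: ratio_error (Y3_gt0 x g).
have ln20 : 0 < ln 2 :> R by rewrite ln_gt0// ltr1n.
have ln21 : ln 2 <= 1 :> R.
  by rewrite (_ : 2 = 1 + 1)// le_ln1Dx// (lt_trans _ ltr01)// ltrN10.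
apply/is_o1P => s soo e e0.
(* 4^-1 gives [|y| <= 1/2], as [normr_expR_sub1] requires, and hence [expR y <= 2]; [e / 8] makes
   [|expR y - 1|] at most [e / 2]. The other half of [e] is [|delta1| * expR y]. *)
pose e' : R := Num.min (e / 8) 4^-1.
have e'0 : 0 < e' by rewrite lt_min divr_gt0//= invr_gt0.
apply: filterS (rate_near s soo e' e'0) => k rk; near=> g.
have g0 : 0 < g by near: g; exact: nbhs_right_gt.
have [delta1 DE d1] : exists2 delta : R,
    D (s k) g = (Y1 (s k) g * (1 + delta))%:E & `|delta| <= e / 4.
  by near: g; apply: dist_near; rewrite divr_gt0.
have [delta2 RE d2] : exists2 delta : R,
    Rate (s k) g = (r g + delta)%:E & `|delta| <= e'.
  by near: g; exact: rk.
pose y := 2 * delta2 * ln 2.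
(* At the limiting rate [r g] the power of 2 equals [g ^+ 2 / (2 pi e sigma ^+ 2)], which turns [Y3]
   into [Y1]; an additive error in the rate becomes the factor [expR (- y)]. *)
have Y3E : Y3 (s k) g = Y1 (s k) g * expR (- y).
  rewrite /Y3 RE /= /powR ifF; last by apply/negbTE; rewrite pnatr_eq0.
  have -> : - 2 * (r g + delta2) * ln 2 =
      - ln (2 * pi * expR 1 * sigma ^+ 2) + 2%:R * ln g - y.
    by rewrite /y /r /log2; field; rewrite gt_eqF.
  rewrite !expRD expRN lnK ?posrE// expRM_natl lnK ?posrE// /Y1.
  move: (pi : R) (pi_gt0 R) (expR 1 : R) (expR_gt0 (1 : R)) => p p0 c1 c10.
  by field; rewrite !gt_eqF.
rewrite DE.
have Y0 := Y1_gt0 (s k) g g0.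
have dE : Y1 (s k) g * (1 + delta1) * (Y3 (s k) g)^-1 - 1 =
    (expR y - 1) + delta1 * expR y.
  rewrite Y3E expRN invfM invrK; field; rewrite gt_eqF//.
rewrite (_ : (_ - 1)%E = ((expR y - 1) + delta1 * expR y)%:E); last first.
  exact: (congr1 EFin dE).
rewrite /= lee_fin.
have [d28 d24] : `|delta2| <= e / 8 /\ `|delta2| <= 4^-1.
  by split; apply: (le_trans d2); rewrite ge_min lexx ?orbT.
have yd : `|y| <= 2 * `|delta2|.
  by rewrite /y !normrM (gtr0_norm ln20) normr_nat ler_piMr ?mulr_ge0.
have ey := normr_expR_sub1 (_ : `|y| <= 2^-1).
have {}ey : `|expR y - 1| <= 2 * `|y| by apply: ey; lra.
have ey2 : expR y <= 2 by have := ler_norm (expR y - 1); lra.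
rewrite (le_trans (ler_normD _ _))// normrM (gtr0_norm (expR_gt0 _)).
have : `|delta1| * expR y <= e / 4 * 2 by rewrite ler_pM// expR_ge0.
by lra.
Unshelve. all: by end_near. Qed.
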